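(* Let $p$ be a prime, let $n\geq 1$, and let $(K,\partial)$ be an $\mathrm{Fr}^n$-differential field of characteristic $p$. Then $(K,\partial)$ is a model of $\mathrm{Fr}^n\text{-}\mathrm{DCF}_p$ if and only if the following condition holds: for all $K$-irreducible $K$-varieties $V,W$ with $W\subseteq V^{(1)}$, if the projection map $W\to V$ is separable, then there is some $a\in V(K)$ such that $(a,\partial(a))\in W$.
   Context: All fields have characteristic $p>0$, $n\ge 1$ is an integer, and $q=p^n$. An $\mathrm{Fr}^n$-derivation on a field $K$ is an additive map $\partial\colon K\to K$ with $\partial(xy)=x^{q}\partial(y)+y^{q}\partial(x)$ for all $x,y\in K$; the pair $(K,\partial)$ is called an $\mathrm{Fr}^n$-differential field. $L^\partial$ is the language of fields together with a unary function symbol $\partial$. $\mathrm{Fr}^n\text{-}\mathrm{DF}_p$ is the $L^\partial$-theory of $\mathrm{Fr}^n$-differential fields of characteristic $p$. It is known (Kowalski) that this theory has a model companion in the language $L^\partial$; this model companion is denoted $\mathrm{Fr}^n\text{-}\mathrm{DCF}_p$. Work in a big algebraically closed field $\Omega$ containing $K$. $K$-varieties are zero loci in affine space over $\Omega$ of ideals of polynomials over $K$. For a $K$-variety $V$ in affine $m$-space, let $I\trianglelefteq K[\bar X]$, $\bar X=(X_1,\dots,X_m)$, be the ideal of all polynomials over $K$ vanishing on $V$. Let $\bar X'=(X_1',\dots,X_m')$ be a new tuple of variables. For $f\in K[\bar X]$ put $$\partial(f)(\bar X,\bar X')=f^{\partial}(\bar X^{q})+\sum_{i=1}^m\left(\frac{\partial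 f}{\partial X_i}(\bar X)\right)^{q}X_i',$$ where $f^\partial$ is obtained from $f$ by applying $\partial$ to the coefficients and $\bar X^q=(X_1^q,\dots,X_m^q)$. Then $V^{(1)}$ (the twisted Frobenius tangent bundle of $V$) is the zero locus of the ideal generated by $I$ and $\partial(I)$ in $K[\bar X,\bar X']$. For $a\in V(K)$ one has $(a,\partial(a))\in V^{(1)}$, where $\partial$ is applied coordinatewise. The projection $V^{(1)}\to V$ is $(\bar x,\bar x')\mapsto \bar x$, and the projection $W\to V$ is its restriction. A separable morphism is by definition dominant: $W\to V$ is separable if it is dominant and the induced extension of function fields $K(V)\subseteq K(W)$ is separable (not necessarily algebraic). *)

(* Defs.v *)
(* boolp is used to turn a vanishing ideal into a boolean predicate, as required
   by the quotient rings of ring_quotient, and to invert units of the quotient. *)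
From HB Require Import structures.
From mathcomp Require Import all_boot all_algebra.
From mathcomp Require Import generic_quotient ring_quotient fraction.
From mathcomp Require Import boolp.
From mathcomp Require Import mpoly.
From Stdlib Require List.

Set Implicit Arguments.
Unset Strict Implicit.
Unset Printing Implicit Defensive.

Import GRing.Theory.
Local Open Scope ring_scope.
Local Open Scope quotient_scope.

(* ** First-order logic in the language of fields with a unary symbol D.
   As usual in the model theory of fields, "language of fields" means
   0, 1, +, -, *; inversion is not a function symbol. *)

Inductive term : Type :=
| Var of nat
| Zero
| One
| Add of term & term
| Opp of term
| Mul of term & term
| Der of term.

(* Variables are named by natural numbers; [All i f] binds variable [i] in
   [f]. *)
Inductive formula : Type :=
| Eq of term & term
| Bot
| Imp of formula & formula
| All of nat & formula.

Definition Not f := Imp f Bot.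
Definition Ex i f := Not (All i (Not f)).

Fixpoint occurs_term (i : nat) (t : term) : bool :=
  match t with
  | Var j => i == j
  | Zero | One => false
  | Add t1 t2 | Mul t1 t2 => occurs_term i t1 || occurs_term i t2
  | Opp t1 | Der t1 => occurs_term i t1
  end.

Fixpoint occurs_free (i : nat) (f : formula) : bool :=
  match f with
  | Eq t1 t2 => occurs_term i t1 || occurs_term i t2
  | Bot => false
  | Imp f1 f2 => occurs_free i f1 || occurs_free i f2
  | All j f1 => (i != j) && occurs_free i f1
  end.

Definition sentence (f : formula) : Prop := forall i, ~~ occurs_free i f.

Record dstruct : Type := DStruct {
  carrier :> Type;
  szero : carrier;
  sone : carrier;
  sadd : carrier -> carrier -> carrier;
  sopp : carrier -> carrier;
  smul : carrier -> carrier -> carrier;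
  sder : carrier -> carrier
}.

Fixpoint eval (M : dstruct) (e : nat -> M) (t : term) : M :=
  match t with
  | Var i => e i
  | Zero => szero M
  | One => sone M
  | Add t1 t2 => sadd (eval e t1) (eval e t2)
  | Opp t1 => sopp (eval e t1)
  | Mul t1 t2 => smul (eval e t1) (eval e t2)
  | Der t1 => sder (eval e t1)
  end.

Definition update (M : Type) (e : nat -> M) (i : nat) (x : M) : nat -> M :=
  fun j => if j == i then x else e j.

Fixpoint holds (M : dstruct) (e : nat -> M) (f : formula) : Prop :=
  match f with
  | Eq t1 t2 => eval e t1 = eval e t2
  | Bot => False
  | Imp f1 f2 => holds e f1 -> holds e f2
  | All i f1 => forall x : M, holds (update e i x) f1
  end.

Definition theory : Type := formula -> Prop.

(* On sentences the truth value does not depend on the environment. *)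
Definition models (M : dstruct) (T : theory) : Prop :=
  forall f, T f -> forall e : nat -> M, holds e f.

Definition embedding (M N : dstruct) (h : M -> N) : Prop :=
  [/\ injective h,
      h (szero M) = szero N /\ h (sone M) = sone N,
      forall x y, h (sadd x y) = sadd (h x) (h y) /\
                  h (smul x y) = smul (h x) (h y),
      forall x, h (sopp x) = sopp (h x)
    & forall x, h (sder x) = sder (h x)].

Definition elementary (M N : dstruct) (h : M -> N) : Prop :=
  forall (f : formula) (e : nat -> M), holds e f <-> holds (h \o e) f.

Definition model_complete (T : theory) : Prop :=
  forall (M N : dstruct) (h : M -> N),
    models M T -> models N T -> embedding h -> elementary h.

Definition embeds_in_models (T T' : theory) : Prop :=
  forall M : dstruct, models M T ->
    exists (N : dstruct) (h : M -> N), models N T' /\ embedding h.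

Definition model_companion (T T' : theory) : Prop :=
  [/\ forall f, T' f -> sentence f,
      embeds_in_models T T', embeds_in_models T' T & model_complete T'].

(* ** The theory of Fr^n-differential fields of characteristic p *)

Definition tpow (t : term) (k : nat) : term := iter k (Mul t) One.
Definition tnat (k : nat) : term := iter k (Add One) Zero.

Definition FrDF_axioms (p n : nat) : seq formula :=
  let q := (p ^ n)%N in
  let x := Var 0 in let y := Var 1 in let z := Var 2 in
  let all1 f := All 0 f in
  let all2 f := All 0 (All 1 f) in
  let all3 f := All 0 (All 1 (All 2 f)) in
  [:: all3 (Eq (Add x (Add y z)) (Add (Add x y) z));
      all2 (Eq (Add x y) (Add y x));
      all1 (Eq (Add Zero x) x);
      all1 (Eq (Add (Opp x) x) Zero);
      all3 (Eq (Mul x (Mul y z)) (Mul (Mul x y) z));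
      all2 (Eq (Mul x y) (Mul y x));
      all1 (Eq (Mul One x) x);
      all3 (Eq (Mul (Add x y) z) (Add (Mul x z) (Mul y z)));
      Not (Eq One Zero);
      all1 (Imp (Not (Eq x Zero)) (Ex 1 (Eq (Mul y x) One)));
      Eq (tnat p) Zero;
      all2 (Eq (Der (Add x y)) (Add (Der x) (Der y)));
      all2 (Eq (Der (Mul x y))
               (Add (Mul (tpow x q) (Der y)) (Mul (tpow y q) (Der x))))].

Definition FrDF (p n : nat) : theory := fun f => List.In f (FrDF_axioms p n).

Definition Fr_derivation (p n : nat) (K : fieldType) (d : K -> K) : Prop :=
  (forall x y, d (x + y) = d x + d y) /\
  (forall x y, d (x * y) = x ^+ (p ^ n) * d y + y ^+ (p ^ n) * d x).

Definition dstruct_of (K : fieldType) (d : K -> K) : dstruct :=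
  @DStruct K 0 1 +%R -%R *%R d.

(* ** K-varieties in affine space over an extension Omega of K *)

Section Varieties.
Variables (K : fieldType) (Omega : closedFieldType).
Variable iota : {rmorphism K -> Omega}.

(* "Big" in the weakest usual sense of a universal domain: Omega has infinite
   transcendence degree over K. *)
Definition infinite_trdeg : Prop :=
  forall m, exists t : 'I_m -> Omega,
    forall f : {mpoly K[m]}, mmap iota t f = 0 -> f = 0.

Definition peval m (f : {mpoly K[m]}) (a : 'rV[Omega]_m) : Omega :=
  mmap iota (fun i => a 0 i) f.

Definition is_ideal m (I : {mpoly K[m]} -> Prop) : Prop :=
  [/\ I 0, forall f g, I f -> I g -> I (f + g) & forall f g, I g -> I (f * g)].

Definition ideal_gen m (S : {mpoly K[m]} -> Prop) : {mpoly K[m]} -> Prop :=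
  fun f => forall I, is_ideal I -> (forall g, S g -> I g) -> I f.

Definition zero_locus m (I : {mpoly K[m]} -> Prop) : 'rV[Omega]_m -> Prop :=
  fun a => forall f, I f -> peval f a = 0.

Definition is_variety m (V : 'rV[Omega]_m -> Prop) : Prop :=
  exists I, is_ideal I /\ forall a, V a <-> zero_locus I a.

(* The empty variety is not irreducible. *)
Definition irreducible m (V : 'rV[Omega]_m -> Prop) : Prop :=
  (exists a, V a) /\
  forall V1 V2, is_variety V1 -> is_variety V2 ->
    (forall a, V a <-> V1 a \/ V2 a) ->
    (forall a, V a <-> V1 a) \/ (forall a, V a <-> V2 a).

Record irr_variety (m : nat) : Type := IrrVariety {
  points :> 'rV[Omega]_m -> Prop;
  irr_is_variety : is_variety points;
  irr_irreducible : irreducible points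
}.

Definition vanishing m (V : 'rV[Omega]_m -> Prop) : {mpoly K[m]} -> Prop :=
  fun f => forall a, V a -> peval f a = 0.

Lemma pevalD m (f g : {mpoly K[m]}) a : peval (f + g) a = peval f a + peval g a.
Proof. exact: mmapD. Qed.

Lemma pevalM m (f g : {mpoly K[m]}) a : peval (f * g) a = peval f a * peval g a.
Proof. exact: rmorphM. Qed.

Lemma peval0 m (a : 'rV[Omega]_m) : peval 0 a = 0.
Proof. exact: mmap0. Qed.

Lemma peval1 m (a : 'rV[Omega]_m) : peval 1 a = 1.
Proof. exact: rmorph1. Qed.

Lemma variety_cut m (V : 'rV[Omega]_m -> Prop) (f : {mpoly K[m]}) :
  is_variety V -> is_variety (fun a => V a /\ peval f a = 0).
Proof.
case=> I [[I0 ID IM] VE].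
exists (fun g => exists2 h, I h & exists c, g = h + c * f); split.
  split.
  - by exists 0 => //; exists 0; rewrite mul0r addr0.
  - move=> _ _ [h1 Ih1 [c1 ->]] [h2 Ih2 [c2 ->]].
    exists (h1 + h2); first exact: ID.
    by exists (c1 + c2); rewrite mulrDl addrACA.
  - move=> g _ [h Ih [c ->]]; exists (g * h); first exact: IM.
    by exists (g * c); rewrite mulrDr mulrA.
move=> a; split.
  case=> /VE Va fa _ [h Ih [c ->]].
  by rewrite pevalD pevalM fa mulr0 addr0; apply: Va.
move=> H; split; last first.
  by apply: H; exists 0 => //; exists 1; rewrite add0r mul1r.
apply/VE => g Ig; apply: H; exists g => //.
by exists 0; rewrite mul0r addr0.
Qed.

(* ** Coordinate rings and function fields *)

Section FunctionField.
Variables (m : nat) (V : irr_variety m).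

Definition vanishing_pred : {mpoly K[m]} -> bool := fun f => `[< vanishing V f >].

Lemma vanishing_idealr_closed : idealr_closed (vanishing_pred : {pred _}).
Proof.
split.
- by apply/asboolP => a _; rewrite peval0.
- apply/negP => /asboolP H; have [[a Va] _] := irr_irreducible V.
  by move/eqP: (H a Va); rewrite peval1 oner_eq0.
- move=> f u v /asboolP Hu /asboolP Hv; apply/asboolP => a Va.
  by rewrite pevalD pevalM Hu // Hv // mulr0 addr0.
Qed.

HB.instance Definition _ :=
  isIdealr.Build {mpoly K[m]} vanishing_pred vanishing_idealr_closed.

Lemma vanishing_prime_closed : prime_idealr_closed (vanishing_pred : {pred _}).
Proof.
move=> f g /asboolP fg.
have [_ irrV] := irr_irreducible V.
have [] := irrV _ _ (variety_cut f (irr_is_variety V))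
                    (variety_cut g (irr_is_variety V)).
- move=> a; split=> [Va|[]]; [|by case|by case].
  move/eqP: (fg a Va); rewrite pevalM mulf_eq0 => /orP[]/eqP ?.
    by left.
  by right.
- by move=> H; apply/orP; left; apply/asboolP => a /H[].
- by move=> H; apply/orP; right; apply/asboolP => a /H[].
Qed.

HB.instance Definition _ :=
  isPrimeIdealrClosed.Build {mpoly K[m]} vanishing_pred vanishing_prime_closed.

Definition vanishing_ideal : prime_idealr {mpoly K[m]} :=
  PrimeIdealr.clone {mpoly K[m]} vanishing_pred _.

(* K[V] = K[X] / I(V). The library only gives the commutative ring structure of
   the quotient; the integral domain structure is added here. *)
Definition coord_ring : Type := {ideal_quot vanishing_ideal}.
HB.instance Definition _ := GRing.ComNzRing.on coord_ring.

Definition coord_unit (x : coord_ring) : bool :=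
  `[< exists y : coord_ring, y * x = 1 >].

Definition coord_inv (x : coord_ring) : coord_ring :=
  if pselect (exists y : coord_ring, y * x = 1) is left H
  then projT1 (cid H) else x.

Lemma coord_mulVx : {in coord_unit, left_inverse 1 coord_inv *%R}.
Proof.
move=> x /asboolP Hx; rewrite /coord_inv; case: pselect => // H.
exact: (projT2 (cid H)).
Qed.

Lemma coord_unitP (x y : coord_ring) : y * x = 1 -> coord_unit x.
Proof. by move=> yx; apply/asboolP; exists y. Qed.

Lemma coord_inv_out : {in [predC coord_unit], coord_inv =1 id}.
Proof.
move=> x; rewrite inE => Hx; rewrite /coord_inv; case: pselect => // H.
by case/negP: Hx; apply/asboolP.
Qed.

HB.instance Definition _ :=
  GRing.ComNzRing_hasMulInverse.Build coord_ring
    coord_mulVx coord_unitP coord_inv_out.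

Lemma coord_integral (x y : coord_ring) : x * y = 0 -> (x == 0) || (y == 0).
Proof. exact: Quotient.rquot_IdomainAxiom. Qed.

HB.instance Definition _ :=
  GRing.ComUnitRing_isIntegral.Build coord_ring coord_integral.

Definition function_field : fieldType := {fraction coord_ring}.

Definition regular_fun (f : {mpoly K[m]}) : function_field :=
  FracField.tofrac (\pi_{ideal_quot vanishing_ideal} f : coord_ring).

End FunctionField.

(* ** Twisted Frobenius tangent bundle. The tuples (X, X') are the left and right
   halves of the 'I_(m + m)-indexed variables. *)

(* f(X) seen in K[X, X'] *)
Definition in_X m (f : {mpoly K[m]}) : {mpoly K[m + m]} :=
  f \mPo [tuple 'X_(lshift m i) | i < m].

Definition prolong (p n : nat) (d : K -> K) m (f : {mpoly K[m]}) :
    {mpoly K[m + m]} :=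
  map_mpoly d f \mPo [tuple 'X_(lshift m i) ^+ (p ^ n) | i < m]
  + \sum_(i < m) in_X (f^`M(i)) ^+ (p ^ n) * 'X_(rshift m i).

Definition twisted_bundle (p n : nat) (d : K -> K) m (V : 'rV[Omega]_m -> Prop) :
    'rV[Omega]_(m + m) -> Prop :=
  zero_locus (ideal_gen (fun g =>
    exists2 f, vanishing V f & g = in_X f \/ g = prolong p n d f)).

(* ** Separable projections *)

(* Separability of a not necessarily algebraic extension L / k in characteristic
   p (Mac Lane; Lang, Algebra, VIII.4): L and k^(1/p) are linearly disjoint over
   k. This is required inside every overfield M of L, and in particular inside
   those which contain all of k^(1/p); the elements of M lying in k^(1/p) are
   those whose p-th power is in k. *)
Definition separable_ext (p : nat) (k L : fieldType) (i : {rmorphism k -> L}) :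
    Prop :=
  forall (M : fieldType) (j : {rmorphism L -> M}) (r : nat) (x : 'I_r -> L),
    (forall c : 'I_r -> k, \sum_t i (c t) * x t = 0 -> forall t, c t = 0) ->
    forall b : 'I_r -> M,
      (forall t, exists c : k, b t ^+ p = j (i c)) ->
      \sum_t b t * j (x t) = 0 -> forall t, b t = 0.

(* The image of W under the projection is Zariski dense in V. *)
Definition dominant_proj m (V : 'rV[Omega]_m -> Prop)
    (W : 'rV[Omega]_(m + m) -> Prop) : Prop :=
  (forall w, W w -> V (lsubmx w)) /\
  forall Z, is_variety Z -> (forall w, W w -> Z (lsubmx w)) ->
    forall v, V v -> Z v.

(* The induced morphism K(V) -> K(W), f |-> f o projection, exists and is unique
   as soon as the projection is dominant. *)
Definition separable_proj (p : nat) m (V : irr_variety m)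
    (W : irr_variety (m + m)) : Prop :=
  dominant_proj V W /\
  exists phi : {rmorphism function_field V -> function_field W},
    (forall f, phi (regular_fun V f) = regular_fun W (in_X f)) /\
    separable_ext p phi.

End Varieties.

(* Main.v *)
From HB Require Import structures.
Require Import Defs.
From mathcomp Require Import all_boot all_algebra.
From mathcomp Require Import order generic_quotient ring_quotient fraction.
From mathcomp Require Import boolp mpoly ring.
From mathcomp Require classical_sets filter.
From Stdlib Require List.

Set Implicit Arguments.
Unset Strict Implicit.
Unset Printing Implicit Defensive.

Import GRing.Theory.
Local Open Scope ring_scope.
Local Open Scope quotient_scope.

(** The models of a model companion are recognized by a finitary lifting
    property.  Call an embedding M -> N locally retractable when every finite
    subset of N admits a map back to M that fixes the elements of M and respects
    the operations, the derivation and distinctness on that subset; this is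
    existential closedness of M in N without formulas.

    For a model complete theory T and an embedding of M into a model N of T, local
    retractability is equivalent to M being an elementary substructure.  One
    direction writes the finitely many atomic facts as one existential formula
    [elementary_locally_retractable].  For the other,
    [locally_retractable_elementary], the retractions glue to an embedding of N
    into an ultrapower of M over M; with Los's theorem this gives a ladder
    M -> N -> M^U -> N^U in which M -> M^U is elementary by Los, N -> N^U by model
    completeness, and M^U -> N^U is again locally retractable, so that an
    induction on formulas goes through.  It remains to see that the geometric
    condition holds if and only if K is locally retractable in every Frobenius
    differential field extending it.

    From the geometric condition to retractions [specialization].  Let N be a
    differential field over K and a a finite tuple of N.  The derivatives D(a)
    may generate an inseparable extension of E = K(a), but they satisfy a system
    of affine equations over E (the equations of the twisted bundle) and possibly
    lie in E for some coordinates; a system of affine equations over E that is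
    solvable in N is solvable in E, by a linear retraction of N onto E
    [affine_retraction].  This gives b in E on the bundle over a with b_i = D(a_i)
    whenever D(a_i) is in E.  The loci V of a and W of (a, b) have the same function
    field E, so W -> V is trivially separable, and the point supplied by the
    geometric condition satisfies every polynomial relation of (a, b).  That the
    loci have the right vanishing ideals is Hilbert's Nullstellensatz
    [nullstellensatz].

    From models of the companion to the geometric condition
    [companion_geometric].  Given W -> V separable with function fields
    K(V) -> K(W), the inclusion of W in the bundle makes f |-> prolong f a
    Frobenius derivation K(V) -> K(W), and separability lets it extend to a
    derivation of K(W) [separable_derivation_extension].  Thus the generic point
    (a, b) of W satisfies b = D(a) in a differential field that embeds in a model
    of the companion; since the ideal of W is finitely generated [hilbert_basis],
    local retractability yields such a point in K. *)

(** * Local retractions and ultrapowers *)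

(** Preservation of distinctness is asked because embeddings of structures are
    injective, and a map that is multiplicative only on a finite set need not be. *)
Definition retracts_on (M N : dstruct) (h : M -> N) (s : seq N) (c : N -> M) :
    Prop :=
  [/\ c (szero N) = szero M /\ c (sone N) = sone M,
      forall x, List.In x s -> c (sopp x) = sopp (c x) /\ c (sder x) = sder (c x),
      forall x y, List.In x s -> List.In y s ->
        [/\ c (sadd x y) = sadd (c x) (c y), c (smul x y) = smul (c x) (c y)
          & c x = c y -> x = y]
    & forall k, List.In (h k) s -> c (h k) = k].

Definition locally_retractable (M N : dstruct) (h : M -> N) : Prop :=
  forall s, exists c, retracts_on h s c.

Definition is_ultrafilter (I : Type) (U : (I -> Prop) -> Prop) : Prop :=
  [/\ forall A B : I -> Prop, U A -> U B -> U (fun i => A i /\ B i),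
      forall A B : I -> Prop, (forall i, A i -> B i) -> U A -> U B,
      ~ U (fun=> False)
    & forall A : I -> Prop, U A \/ U (fun i => ~ A i)].

(** The sets of all finite lists extending a given one have the finite
    intersection property. *)
Lemma ultrafilter_of_tails (T : Type) :
  exists2 U : (seq T -> Prop) -> Prop, is_ultrafilter U &
    forall s, U (fun t => forall x, List.In x s -> List.In x t).
Proof.
pose F : classical_sets.set_system (seq T) := fun A =>
  exists s, forall t, (forall x, List.In x s -> List.In x t) -> A t.
have FF : filter.ProperFilter F.
  apply: filter.Build_ProperFilter; first by case=> s /(_ s); apply.
  split.
  - by exists nil.
  - move=> A B [s sA] [t tB]; exists (s ++ t) => r rst; split.
      by apply: sA => x xs; apply: rst; apply/List.in_or_app; left.
    by apply: tB => x xs; apply: rst; apply/List.in_or_app; right.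
  - by move=> A B AB [s sA]; exists s => t /sA /AB.
have [U [UU FU]] := filter.ultraFilterLemma FF.
have PF := filter.ultra_proper (F := U).
exists U; last by move=> s; apply: FU; exists s.
split.
- by move=> A B UA UB; apply: filter.filterI.
- by move=> A B AB; apply: filter.filterS.
- exact: filter.filter_not_empty.
- by move=> A; apply: filter.in_ultra_setVsetC.
Qed.

Section Ultrapower.
Variables (I : Type) (U : (I -> Prop) -> Prop).
Hypothesis U_ultra : is_ultrafilter U.

Lemma ultraI (A B : I -> Prop) : U A -> U B -> U (fun i => A i /\ B i).
Proof. by case: U_ultra => H _ _ _; apply: H. Qed.

Lemma ultraS (A B : I -> Prop) : (forall i, A i -> B i) -> U A -> U B.
Proof. by case: U_ultra => _ H _ _; apply: H. Qed.

Lemma ultraI_S (A B C : I -> Prop) :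
  (forall i, A i -> B i -> C i) -> U A -> U B -> U C.
Proof. by move=> H UA UB; apply: ultraS (ultraI UA UB) => i []; apply: H. Qed.

Lemma ultraNot (A : I -> Prop) : U (fun i => ~ A i) <-> ~ U A.
Proof.
case: U_ultra => HI HS H0 HC; split=> [UN UA|].
  by apply: H0; apply: HS (HI _ _ UN UA) => i [].
by case: (HC A).
Qed.

Lemma ultraT (A : I -> Prop) : (forall i, A i) -> U A.
Proof.
move=> HA; case: U_ultra => _ HS H0 HC; case: (HC A) => // UN.
by case: H0; apply: HS UN => i /(_ (HA i)).
Qed.

Section Carrier.
Variable M : Type.

Definition ae_eq (f g : I -> M) : Prop := U (fun i => f i = g i).

(** The quotient of the functions I -> M by equality U-almost everywhere,
    represented by the equivalence classes themselves. *)
Definition ultra_car : Type := {A : (I -> M) -> Prop | exists f, A = ae_eq f}.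

Definition ucls (f : I -> M) : ultra_car :=
  exist (fun A => exists f, A = ae_eq f) (ae_eq f) (ex_intro _ f erefl).

Definition urep (x : ultra_car) : I -> M := projT1 (cid (proj2_sig x)).

Lemma ae_eq_sym f g : ae_eq f g -> ae_eq g f.
Proof. by apply: ultraS. Qed.

Lemma ae_eq_trans g f k : ae_eq f g -> ae_eq g k -> ae_eq f k.
Proof. by apply: ultraI_S => i ->. Qed.

Lemma uclsE f g : ucls f = ucls g <-> ae_eq f g.
Proof.
split=> [[/(congr1 (fun A => A g)) E]|fg].
  by rewrite E; apply: ultraT.
apply: eq_exist; apply: funext => k; apply: propext.
by split; apply: ae_eq_trans => //; apply: ae_eq_sym.
Qed.

Lemma urepK x : ucls (urep x) = x.
Proof.
rewrite /urep; case: cid => f /= E; case: x E => A P /= E.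
by apply: eq_exist; rewrite E.
Qed.

Lemma uclsK f : ae_eq (urep (ucls f)) f.
Proof. by apply/uclsE; rewrite urepK. Qed.

Lemma urep_inj x y : ae_eq (urep x) (urep y) <-> x = y.
Proof. by rewrite -uclsE !urepK. Qed.

End Carrier.

Definition upow (M : dstruct) : dstruct :=
  @DStruct (ultra_car M)
    (ucls (fun=> szero M)) (ucls (fun=> sone M))
    (fun x y => ucls (fun i => sadd (urep x i) (urep y i)))
    (fun x => ucls (fun i => sopp (urep x i)))
    (fun x y => ucls (fun i => smul (urep x i) (urep y i)))
    (fun x => ucls (fun i => sder (urep x i))).

Lemma upow_eval (M : dstruct) (r : nat -> I -> M) t :
  @eval (upow M) (fun j => ucls (r j)) t = ucls (fun i => eval (r^~ i) t).
Proof.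
pose ev t := ucls (fun i => eval (r^~ i) t).
have K t' : ae_eq (urep (ev t')) (fun i => eval (r^~ i) t') by apply: uclsK.
elim: t => //= [t1 -> t2 ->|t ->|t1 -> t2 ->|t ->]; apply/uclsE.
- by apply: ultraI_S (K t1) (K t2) => i -> ->.
- by apply: ultraS (K t) => i ->.
- by apply: ultraI_S (K t1) (K t2) => i -> ->.
- by apply: ultraS (K t) => i ->.
Qed.

Lemma upow_update (M : dstruct) (r : nat -> I -> M) j (x : I -> M) :
  update (fun k => ucls (r k)) j (ucls x) = (fun k => ucls (update r j x k)).
Proof. by apply: funext => k; rewrite /update; case: eqP. Qed.

Lemma update_app (M : Type) (r : nat -> I -> M) j (x : I -> M) i :
  (update r j x)^~ i = update (r^~ i) j (x i).
Proof. by apply: funext => k; rewrite /update; case: eqP. Qed.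

(** Los's theorem. It is stated for an arbitrary family r of representatives
    because an environment has infinitely many values: changing the
    representative of each of them is not an almost everywhere change. *)
Lemma upow_holds (M : dstruct) f (r : nat -> I -> M) :
  @holds (upow M) (fun j => ucls (r j)) f <-> U (fun i => holds (r^~ i) f).
Proof.
elim: f r => [t1 t2||f1 IH1 f2 IH2|j f IH] r /=.
- by rewrite !upow_eval uclsE.
- by case: U_ultra.
- rewrite IH1 IH2; split=> [H|H H1]; last by apply: ultraI_S H H1 => i; apply.
  have [H1|/ultraNot H1] := EM (U (fun i => holds (r^~ i) f1)).
    by apply: ultraS (H H1).
  by apply: ultraS H1 => i H1.
- split=> [H|H x]; last first.
    rewrite -(urepK x) upow_update; apply/IH; apply: ultraS H => i.
    by rewrite update_app; apply.
  apply: contrapT => /ultraNot H1.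
  have /choice[x xP] i : exists z, ~ (forall y : M, holds (update (r^~ i) j y) f) ->
      ~ holds (update (r^~ i) j z) f.
    have [Hi|/existsNP[y Hy]] := EM (forall y : M, holds (update (r^~ i) j y) f).
      by exists (szero M).
    by exists y.
  have := H (ucls x); rewrite upow_update => /IH /ultraI /(_ H1).
  case: U_ultra => _ HS H0 _; move=> H2; apply: H0; apply: HS H2 => i [].
  by rewrite update_app => H2 /xP.
Qed.

Definition diag (M : dstruct) (x : M) : upow M := ucls (fun=> x).

Lemma ultra_const (P : Prop) : U (fun=> P) <-> P.
Proof.
split=> [UP|HP]; last exact: ultraT.
by apply: contrapT => nP; case: U_ultra => _ HS H0 _; apply: H0; apply: HS UP.
Qed.

Lemma diag_elementary (M : dstruct) : elementary (@diag M).
Proof. by move=> f e; rewrite (upow_holds f (fun j => fun=> e j)) ultra_const. Qed.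

Lemma models_upow (M : dstruct) T : models M T -> models (upow M) T.
Proof.
move=> MT f Tf e; have -> : e = fun j => ucls (urep (e j)).
  by apply: funext => j; rewrite urepK.
by apply/upow_holds/ultraT => i; apply: MT.
Qed.

Section Map.
Variables (M N : dstruct) (h : M -> N).

Definition umap (x : upow M) : upow N := ucls (fun i => h (urep x i)).

Lemma umap_cls f : umap (ucls f) = ucls (fun i => h (f i)).
Proof. by apply/uclsE; apply: ultraS (uclsK f) => i ->. Qed.

Lemma urep_umap x : ae_eq (urep (umap x)) (fun i => h (urep x i)).
Proof. exact: uclsK. Qed.

Lemma umap_embedding : embedding h -> embedding umap.
Proof.
case=> h_inj [h0 h1] hDM hN hd; split=> /=.
- move=> x y /uclsE xy; apply/urep_inj; apply: ultraS xy => i; exact: h_inj.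
- by rewrite !umap_cls h0 h1.
- move=> x y; rewrite !umap_cls; split; apply/uclsE;
    apply: ultraI_S (urep_umap x) (urep_umap y) => i -> ->;
    by case: (hDM (urep x i) (urep y i)).
- by move=> x; rewrite umap_cls; apply/uclsE; apply: ultraS (urep_umap x) => i ->.
- by move=> x; rewrite umap_cls; apply/uclsE; apply: ultraS (urep_umap x) => i ->.
Qed.

Lemma umap_locally_retractable :
  locally_retractable h -> locally_retractable umap.
Proof.
move=> h_lr s.
have [c cP] := choice (fun i => h_lr [seq urep x i | x <- s]).
have inS x i : List.In x s -> List.In (urep x i) [seq urep x i | x <- s].
  exact: (List.in_map (fun x : upow N => urep x i)).
pose C x i := c i (urep x i).
have KC x : ae_eq (urep (ucls (C x))) (C x) by apply: uclsK.
exists (fun x => ucls (C x)); split=> /=.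
- split; apply/uclsE.
    apply: ultraS (uclsK (fun=> szero N)) => i; rewrite /C => ->.
    by case: (cP i) => [[]].
  apply: ultraS (uclsK (fun=> sone N)) => i; rewrite /C => ->.
  by case: (cP i) => [[]].
- move=> x xs; split; apply/uclsE.
    apply: ultraI_S (uclsK (fun i => sopp (urep x i))) (KC x) => i.
    by move=> E ->; rewrite /C E; case: (cP i) => _ /(_ _ (inS _ _ xs))[].
  apply: ultraI_S (uclsK (fun i => sder (urep x i))) (KC x) => i.
  by move=> E ->; rewrite /C E; case: (cP i) => _ /(_ _ (inS _ _ xs))[].
- move=> x y xs ys; split; try apply/uclsE.
  + apply: ultraI_S (uclsK (fun i => sadd (urep x i) (urep y i)))
      (ultraI (KC x) (KC y)) => i E [-> ->]; rewrite /C E.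
    by case: (cP i) => _ _ /(_ _ _ (inS _ i xs) (inS _ i ys))[].
  + apply: ultraI_S (uclsK (fun i => smul (urep x i) (urep y i)))
      (ultraI (KC x) (KC y)) => i E [-> ->]; rewrite /C E.
    by case: (cP i) => _ _ /(_ _ _ (inS _ i xs) (inS _ i ys))[].
  + move=> /uclsE xy; apply/urep_inj; apply: ultraS xy => i.
    by case: (cP i) => _ _ /(_ _ _ (inS _ i xs) (inS _ i ys))[].
- move=> k ks; rewrite -[RHS]urepK; apply/uclsE.
  apply: ultraS (uclsK (fun i => h (urep k i))) => i E.
  by rewrite /C /umap E; case: (cP i) => _ _ _; apply; rewrite -E; apply: inS.
Qed.

End Map.
End Ultrapower.

Lemma embedding_comp (M N P : dstruct) (g : N -> P) (h : M -> N) :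
  embedding g -> embedding h -> embedding (g \o h).
Proof.
case=> g_inj [g0 g1] gDM gN gd [h_inj [h0 h1] hDM hN hd]; split=> /=.
- exact: inj_comp.
- by rewrite h0 h1.
- by move=> x y; case: (hDM x y) => -> ->; apply: gDM.
- by move=> x; rewrite hN.
- by move=> x; rewrite hd.
Qed.

(** Index the ultrapower by the finite subsets of N and send x to the class of
    s |-> c_s(x), where c_s is a retraction on s: almost every s contains any
    given finite set of elements. *)
Lemma locally_retractable_upow (M N : dstruct) (h : M -> N) :
  locally_retractable h ->
  exists (U : (seq N -> Prop) -> Prop) (g : N -> upow U M),
    [/\ is_ultrafilter U, embedding g & forall k, g (h k) = diag U k].
Proof.
move=> h_lr; have [U U_ultra UT] := ultrafilter_of_tails N.
have [c cP] := choice h_lr.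
pose g x : upow U M := ucls U (fun s => c s x).
have ae (x : N) A : (forall s, List.In x s -> A s) -> U A.
  by move=> H; apply: ultraS U_ultra _ _ _ (UT [:: x]) => s /(_ x (or_introl erefl)) /H.
have ae2 (x y : N) A : (forall s, List.In x s -> List.In y s -> A s) -> U A.
  move=> H; apply: ultraS U_ultra _ _ _ (UT [:: x; y]) => s Hs.
  by apply: H; apply: Hs; rewrite /=; auto.
exists U, g; split=> //; last first.
  move=> k; apply/(uclsE U_ultra); apply: (ae (h k)) => s ks.
  by case: (cP s) => _ _ _; apply.
split=> /=.
- move=> x y /(uclsE U_ultra) /(ultraI U_ultra) xy.
  have /xy : U (fun s => List.In x s /\ List.In y s) by apply: (ae2 x y).
  move=> H; apply: contrapT => nxy; case: U_ultra => _ HS H0 _; apply: H0.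
  apply: HS H => s [E [xs ys]]; apply: nxy.
  by case: (cP s) => _ _ /(_ x y xs ys)[_ _ /(_ E)].
- split; apply/(uclsE U_ultra); apply: (ultraT U_ultra) => s.
    by case: (cP s) => [[]].
  by case: (cP s) => [[]].
- move=> x y; split; apply/(uclsE U_ultra);
    (apply: (ultraI_S U_ultra) (ae2 x y (fun s => List.In x s /\ List.In y s) _)
       (ultraI U_ultra (uclsK U_ultra (c^~ x)) (uclsK U_ultra (c^~ y))) => //;
     move=> s [xs ys] [-> ->]; by case: (cP s) => _ _ /(_ x y xs ys)[]).
- move=> x; apply/(uclsE U_ultra).
  apply: (ultraI_S U_ultra) (ae x (List.In x) _) (uclsK U_ultra (c^~ x)) => // s xs ->.
  by case: (cP s) => _ /(_ x xs)[].
- move=> x; apply/(uclsE U_ultra).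
  apply: (ultraI_S U_ultra) (ae x (List.In x) _) (uclsK U_ultra (c^~ x)) => // s xs ->.
  by case: (cP s) => _ /(_ x xs)[].
Qed.

(** Induction on formulas, for all locally retractable embeddings into models of
    T at once.  The only hard case is a universal formula true in M and an element
    x of N: the formula holds in M^U at the image of x, the induction hypothesis
    for M^U -> N^U carries it to N^U, and N -> N^U is elementary. *)
Lemma locally_retractable_elementary T (M N : dstruct) (h : M -> N) :
  model_complete T -> models N T -> embedding h -> locally_retractable h ->
  elementary h.
Proof.
move=> Tmc NT h_emb h_lr f; elim: f M N h NT h_emb h_lr => /=
    [t1 t2||f1 IH1 f2 IH2|j f IH] M N h NT h_emb h_lr e.
- have evalE t : eval (h \o e) t = h (eval e t).
    case: h_emb => _ [h0 h1] hDM hN hd.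
    elim: t => //= [t3 -> t4 ->|t ->|t3 -> t4 ->|t ->] //.
      by case: (hDM (eval e t3) (eval e t4)).
    by case: (hDM (eval e t3) (eval e t4)).
  by rewrite !evalE; split=> [->//|]; case: h_emb => h_inj _ _ _ _ /h_inj.
- by [].
- by rewrite (IH1 M N h) // (IH2 M N h).
- have updE (P Q : dstruct) (g : P -> Q) e' x :
      g \o update e' j x = update (g \o e') j (g x).
    by apply: funext => k; rewrite /update /=; case: eqP.
  split=> H x; last by apply/(IH M N h) => //; rewrite updE; apply: H.
  (* Ladder M -> N -> M^U -> N^U with maps h, g and umap h. *)
  have [U [g [U_ultra g_emb gh]]] := locally_retractable_upow h_lr.
  have NU := models_upow U_ultra NT.
  have hU_emb := umap_embedding U_ultra h_emb.
  have hU_lr := umap_locally_retractable U_ultra h_lr.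
  have /Tmc E := embedding_comp hU_emb g_emb.
  apply/E => //; rewrite updE.
  have -> : (umap h \o g) \o (h \o e) = umap h \o (@diag _ U M \o e).
    by apply: funext => k /=; rewrite gh.
  rewrite -(updE _ _ (umap h) (@diag _ U M \o e) (g x)).
  apply/(IH _ _ _ NU hU_emb hU_lr).
  by have := (diag_elementary U_ultra (All j f) e).1 H; apply.
Qed.

(** * Elementary embeddings are locally retractable *)

Definition Conj (fs : seq formula) : formula :=
  Not (foldr Imp Bot fs).

Lemma holds_Conj (M : dstruct) (e : nat -> M) fs :
  holds e (Conj fs) <-> forall f, List.In f fs -> holds e f.
Proof.
rewrite /Conj /=; elim: fs => [|f fs IH] /=; first by split => // _; apply.
split=> [H g|H H1].
  case=> [<-|fsg]; first by apply: contrapT => nf; apply: H.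
  by apply/(IH.1 _ g fsg) => H1; apply: H => _.
by apply: IH.2 (H1 (H f (or_introl erefl))) => g gs; apply: H; right.
Qed.

Fixpoint Exs (m : nat) (f : formula) : formula :=
  if m is m'.+1 then Ex m' (Exs m' f) else f.

Definition mix (T : Type) (m : nat) (x e : nat -> T) : nat -> T :=
  fun i => if (i < m)%N then x i else e i.

Lemma holds_Exs (M : dstruct) m f (e : nat -> M) :
  holds e (Exs m f) <-> exists x, holds (mix m x e) f.
Proof.
have mixS (x e' : nat -> M) i : mix i x (update e' i (x i)) = mix i.+1 x e'.
  apply: funext => j; rewrite /mix /update ltnS [(j <= i)%N]leq_eqVlt.
  by case: (eqVneq j i) => [->|_] /=; [rewrite ltnn|].
elim: m e => [|m IH] e /=; first by split=> [H|[x]]; [exists e|].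
split=> [/existsNP[y /contrapT/IH[x xH]]|[x xH] H]; last first.
  by apply: (H (x m)); apply/IH; exists x; rewrite mixS.
exists (update x m y); rewrite -mixS; congr (holds _ f): xH.
apply: funext => i; rewrite /mix /update eqxx.
by case: (eqVneq i m) => [->|_]; rewrite ?ltnn.
Qed.

Definition atomic_fact (N : dstruct) (e : nat -> N) (t : term * term) : formula :=
  if `[< eval e t.1 = eval e t.2 >] then Eq t.1 t.2 else Not (Eq t.1 t.2).

Lemma atomic_fact_holds (N : dstruct) (e : nat -> N) t : holds e (atomic_fact e t).
Proof. by rewrite /atomic_fact; case: asboolP. Qed.

Lemma holds_atomic_fact (M N : dstruct) (e : nat -> N) (e' : nat -> M) t :
  holds e' (atomic_fact e t) -> (eval e' t.1 = eval e' t.2 <-> eval e t.1 = eval e t.2).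
Proof. by rewrite /atomic_fact; case: asboolP => E /= E'; split. Qed.

(** Variables below m are unknowns, the others are parameters from M. The
    conjunction of the atomic facts and their negations on ts is true in N, hence
    so is its existential closure, which descends to M. *)
Lemma elementary_pattern (M N : dstruct) (h : M -> N) (ts : seq term) m
    (u : nat -> N) (k : nat -> M) :
  elementary h -> exists x : nat -> M, forall t1 t2, List.In t1 ts -> List.In t2 ts ->
    (eval (mix m x k) t1 = eval (mix m x k) t2 <->
     eval (mix m u (h \o k)) t1 = eval (mix m u (h \o k)) t2).
Proof.
move=> h_el; pose e := mix m u (h \o k).
have : holds (h \o k) (Exs m (Conj (map (atomic_fact e) (List.list_prod ts ts)))).
  apply/holds_Exs; exists u; apply/holds_Conj => f /List.in_map_iff[t [<- _]].
  exact: atomic_fact_holds.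
move=> /h_el /holds_Exs[x /holds_Conj H]; exists x => t1 t2 t1s t2s.
apply: (@holds_atomic_fact _ _ _ _ (t1, t2)); apply: H.
by apply: List.in_map; apply: List.in_prod.
Qed.

Lemma elementary_locally_retractable (M N : dstruct) (h : M -> N) :
  elementary h -> locally_retractable h.
Proof.
move=> h_el s.
have h_inj : injective h.
  move=> a b ab; pose e i := if i is 0%N then a else b.
  exact: (h_el (Eq (Var 0) (Var 1)) e).2 ab.
 pose m := size s.
pose u i := List.nth i s (szero N).
have /choice[k0 k0P] i : exists k, (exists k, h k = u i) -> h k = u i.
  by have [[k E]|H] := EM (exists k, h k = u i); [exists k|exists (szero M)].
(* The variable m + i is a parameter naming the element k0 i of M, which is a
   preimage of the i-th element of s if there is one. *)
pose k i := k0 (i - m)%N.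
pose r := List.seq 0 (m + m).
pose op2 (f : term -> term -> term) :=
  List.flat_map (fun i => List.map (fun j => f (Var i) (Var j)) r) r.
pose op1 (f : term -> term) := List.map (fun i => f (Var i)) r.
pose ts := List.concat
  [:: [:: Zero; One]; op1 id; op1 Opp; op1 Der; op2 Add; op2 Mul].
have [x xP] := elementary_pattern ts m u k h_el.
set eM := mix m x k in xP; set eN := mix m u (h \o k) in xP.
have inr i : (i < m + m)%N -> List.In i r.
  by move=> im; apply/List.in_seq; split; apply/leP; rewrite ?leq0n.
have in_op1 f i : (i < m + m)%N -> List.In (f (Var i)) (op1 f).
  by move=> /inr; apply: (List.in_map (fun i => f (Var i))).
have in_op2 f i j : (i < m + m)%N -> (j < m + m)%N ->
    List.In (f (Var i) (Var j)) (op2 f).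
  move=> /inr ir /inr jr; apply/List.in_flat_map; exists i; split=> //.
  exact: (List.in_map (fun j => f (Var i) (Var j))).
have tsP t : List.In t ts <->
    t = Zero \/ t = One \/ List.In t (op1 id) \/ List.In t (op1 Opp) \/
    List.In t (op1 Der) \/ List.In t (op2 Add) \/ List.In t (op2 Mul).
  by rewrite /ts /= !List.in_app_iff /=; intuition.
have /choice[c cP] y : exists z, forall t, List.In t ts -> eval eN t = y ->
    z = eval eM t.
  have [[t [tts <-]]|H] := EM (exists t, List.In t ts /\ eval eN t = y).
    by exists (eval eM t) => t' t'ts E; apply/xP.
  by exists (szero M) => t tts ty; case: H; exists t.
have cE t : List.In t ts -> c (eval eN t) = eval eM t by move=> /cP; apply.
have inS y : List.In y s -> exists i, (i < m)%N /\ eval eN (Var i) = y.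
  move=> /(List.In_nth _ _ (szero N))[i [/ltP im E]]; exists i; split=> //.
  by rewrite /= /eN /mix im.
have mm i : (i < m)%N -> (i < m + m)%N by move=> im; rewrite ltn_addr.
exists c; split.
- by split; [apply: (cE Zero)|apply: (cE One)]; apply/tsP; auto.
- move=> _ /inS[i [/mm im <-]]; rewrite (cE (Var i)) //; last first.
    by apply/tsP; do 2 right; left; apply: (in_op1 id).
  split.
    by apply: (cE (Opp (Var i))); apply/tsP; do 3 right; left; apply: in_op1.
  by apply: (cE (Der (Var i))); apply/tsP; do 4 right; left; apply: in_op1.
- move=> _ _ /inS[i [/mm im <-]] /inS[j [/mm jm <-]].
  have vi l : (l < m + m)%N -> List.In (Var l) ts.
    by move=> lm; apply/tsP; do 2 right; left; apply: (in_op1 id).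
  rewrite (cE (Var i)) ?(cE (Var j)); try exact: vi.
  split; last by move/xP; apply; apply: vi.
    by apply: (cE (Add (Var i) (Var j))); apply/tsP; do 5 right; left; apply: in_op2.
  by apply: (cE (Mul (Var i) (Var j))); apply/tsP; do 6 right; apply: in_op2.
- move=> l /inS[i [im E]].
  have E' : eval eN (Var (m + i)) = h l.
    rewrite -E /= /eN /mix im ltnNge leq_addr /= /k addKn; apply: k0P.
    by exists l; rewrite -E /= /eN /mix im.
  rewrite -E' (cE (Var (m + i))); last first.
    by apply/tsP; do 2 right; left; apply: (in_op1 id); rewrite ltn_add2l.
  rewrite /= /eM /mix ltnNge leq_addr /= /k addKn.
  have Ei : h l = u i by rewrite -E /= /eN /mix im.
  by apply: h_inj; rewrite k0P; [rewrite Ei|exists l].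
Qed.

(** * Models of the axioms as fields *)

Lemma eval_tpow (K : fieldType) (d : K -> K) (e : nat -> K) t k :
  @eval (dstruct_of d) e (tpow t k) = (@eval (dstruct_of d) e t : K) ^+ k.
Proof. by elim: k => [//|k IH] /=; rewrite -/(tpow t k) IH exprS. Qed.

Lemma eval_tnat (K : fieldType) (d : K -> K) (e : nat -> K) k :
  @eval (dstruct_of d) e (tnat k) = k%:R.
Proof. by elim: k => [//|k IH] /=; rewrite -/(tnat k) IH -natr1 addrC. Qed.

Lemma models_FrDF (p n : nat) (K : fieldType) (d : K -> K) :
  p \in [pchar K] -> Fr_derivation p n d -> models (dstruct_of d) (FrDF p n).
Proof.
move=> charK [dD dM] f fT e.
case: fT => [<-|]; first by move=> x y z; apply: addrA.
case=> [<-|]; first by move=> x y; apply: addrC.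
case=> [<-|]; first by move=> x; apply: add0r.
case=> [<-|]; first by move=> x; apply: addNr.
case=> [<-|]; first by move=> x y z; apply: mulrA.
case=> [<-|]; first by move=> x y; apply: mulrC.
case=> [<-|]; first by move=> x; apply: mul1r.
case=> [<-|]; first by move=> x y z; apply: mulrDl.
case=> [<-|]; first by move=> /eqP; rewrite oner_eq0.
case=> [<-|].
  by move=> x /eqP x0 /(_ x^-1); apply; apply: mulVf.
case=> [<-|]; first by rewrite /= eval_tnat; apply/eqP; rewrite -(dvdn_pcharf charK).
case=> [<-|]; first by move=> x y; apply: dD.
case=> [<-|//]; move=> x y.
by rewrite /= !eval_tpow; apply: dM.
Qed.

(** The proof that M is a model is a parameter of the carrier, so that the field
    structure, which depends on it, can be attached to the type. *)
Definition mfield_of (M : dstruct) T of models M T : Type := carrier M.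

Section FieldOfModel.
Variables (p n : nat) (M : dstruct).
Hypothesis MT : models M (FrDF p n).

Notation mfield := (mfield_of MT).

Let ax k : (k < 13)%N -> holds (fun=> szero M) (nth Bot (FrDF_axioms p n) k).
Proof.
move=> lk; apply: MT; rewrite /FrDF.
have -> : nth Bot (FrDF_axioms p n) k = List.nth k (FrDF_axioms p n) Bot.
  by move: (FrDF_axioms p n) {lk} => s; elim: s k => [[|k]|f s IH [|k]] //=.
by apply: List.nth_In; apply/ltP.
Qed.

Lemma mfield_addA : associative (@sadd M).
Proof. by move=> x y z; apply: (ax (k := 0) isT x y z). Qed.
Lemma mfield_addC : commutative (@sadd M).
Proof. by move=> x y; apply: (ax (k := 1) isT x y). Qed.
Lemma mfield_add0 : left_id (szero M) (@sadd M).
Proof. by move=> x; apply: (ax (k := 2) isT x). Qed.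
Lemma mfield_addN : left_inverse (szero M) (@sopp M) (@sadd M).
Proof. by move=> x; apply: (ax (k := 3) isT x). Qed.
Lemma mfield_mulA : associative (@smul M).
Proof. by move=> x y z; apply: (ax (k := 4) isT x y z). Qed.
Lemma mfield_mulC : commutative (@smul M).
Proof. by move=> x y; apply: (ax (k := 5) isT x y). Qed.
Lemma mfield_mul1 : left_id (sone M) (@smul M).
Proof. by move=> x; apply: (ax (k := 6) isT x). Qed.
Lemma mfield_mulD : left_distributive (@smul M) (@sadd M).
Proof. by move=> x y z; apply: (ax (k := 7) isT x y z). Qed.
Lemma mfield_nonzero : sone M <> szero M.
Proof. exact: (ax (k := 8) isT). Qed.
Lemma mfield_inverse (x : M) : x <> szero M -> exists y, smul y x = sone M.
Proof.
by move=> x0; have /existsNP[y /contrapT yx] := ax (k := 9) isT x x0; exists y.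
Qed.

HB.instance Definition _ := gen_eqMixin mfield.
HB.instance Definition _ := gen_choiceMixin mfield.
HB.instance Definition _ := @GRing.isZmodule.Build mfield _ _ _
  mfield_addA mfield_addC mfield_add0 mfield_addN.
Lemma mfield_nonzerob : (sone M : mfield) != szero M.
Proof. by apply/eqP/mfield_nonzero. Qed.
HB.instance Definition _ := @GRing.Zmodule_isComNzRing.Build mfield _ _
  mfield_mulA mfield_mulC mfield_mul1 mfield_mulD mfield_nonzerob.

Definition mfield_inv (x : mfield) : mfield :=
  if pselect (exists y : M, smul y x = sone M) is left H
  then projT1 (cid H) else szero M.

Lemma mfield_mulV (x : mfield) : x != 0 -> mfield_inv x * x = 1.
Proof.
move/eqP=> x0; rewrite /mfield_inv; case: pselect => [H|]; first by case: cid.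
by case; apply: mfield_inverse.
Qed.

Lemma mfield_inv0 : mfield_inv 0 = 0.
Proof.
rewrite /mfield_inv; case: pselect => // -[y yE]; case: mfield_nonzero.
by rewrite -yE; apply: (mulr0 (y : mfield)).
Qed.

HB.instance Definition _ := GRing.ComNzRing_isField.Build mfield
  mfield_mulV mfield_inv0.

Definition mder : mfield -> mfield := @sder M.

Lemma mder_struct : dstruct_of mder = M.
Proof.
have eta (N : dstruct) : @DStruct N (szero N) (sone N) (@sadd N) (@sopp N)
  (@smul N) (@sder N) = N by case: N.
exact: eta.
Qed.

Lemma mfield_holds (f : formula) :
  (forall e : nat -> M, holds e f) -> forall e, @holds (dstruct_of mder) e f.
Proof. by move=> H; rewrite mder_struct. Qed.

Lemma mfield_pchar : prime p -> p \in [pchar mfield].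
Proof.
move=> p_prime; rewrite inE p_prime /= -(@eval_tnat _ mder (fun=> 0)).
apply/eqP; apply: (@mfield_holds (Eq (tnat p) Zero)) => e.
by apply: MT; rewrite /FrDF /=; do 10 right; left.
Qed.

Lemma mder_derivation : Fr_derivation p n mder.
Proof.
split=> x y; first exact: (ax (k := 11) isT x y).
have H : forall e : nat -> M, holds e (nth Bot (FrDF_axioms p n) 12).
  by move=> e; apply: MT; rewrite /FrDF /=; do 12 right; left.
by have := mfield_holds H (fun=> 0) x y; rewrite /= !eval_tpow.
Qed.
End FieldOfModel.

Lemma FrDF_model (p n : nat) (M : dstruct) :
  prime p -> models M (FrDF p n) ->
  exists (F : fieldType) (D : F -> F),
    [/\ p \in [pchar F], Fr_derivation p n D & dstruct_of D = M].
Proof.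
move=> p_prime MT; exists (mfield_of MT), (@mder _ _ _ MT); split.
- exact: mfield_pchar.
- exact: mder_derivation.
- exact: mder_struct.
Qed.

(** * Subrings and subfields generated by an image *)

Section ImageRing.
Variables (R : comNzRingType) (L : fieldType) (r : {rmorphism R -> L}).

Definition image_pred : {pred L} := fun x => `[< exists f, x = r f >].

Lemma image_subring_closed : subring_closed image_pred.
Proof.
split.
- by apply/asboolP; exists 1; rewrite rmorph1.
- move=> _ _ /asboolP[f ->] /asboolP[g ->]; apply/asboolP.
  by exists (f - g); rewrite rmorphB.
- move=> _ _ /asboolP[f ->] /asboolP[g ->]; apply/asboolP.
  by exists (f * g); rewrite rmorphM.
Qed.

HB.instance Definition _ :=
  GRing.isSubringClosed.Build L image_pred image_subring_closed.

Record image_ring := ImageElt { image_val : L; _ : image_val \in image_pred }.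
HB.instance Definition _ := [isSub for image_val].
HB.instance Definition _ := [Choice of image_ring by <:].
HB.instance Definition _ := [SubChoice_isSubComNzRing of image_ring by <:].

End ImageRing.

Section FracRing.
Variables (R : comNzRingType) (L : fieldType) (r : {rmorphism R -> L}).

Definition frac_pred : {pred L} :=
  fun x => `[< exists f g, r g != 0 /\ x = r f / r g >].

Lemma frac_divring_closed : divring_closed frac_pred.
Proof.
split.
- by apply/asboolP; exists 1, 1; rewrite rmorph1 oner_neq0 divr1.
- move=> _ _ /asboolP[f [g [g0 ->]]] /asboolP[f' [g' [g'0 ->]]]; apply/asboolP.
  exists (f * g' - f' * g), (g * g'); rewrite rmorphB !rmorphM mulf_neq0 //.
  by split=> //; field; rewrite g0 g'0.
- move=> _ _ /asboolP[f [g [g0 ->]]] /asboolP[f' [g' [g'0 ->]]]; apply/asboolP.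
  have [f'0|f'0] := eqVneq (r f') 0.
    by exists 0, 1; rewrite rmorph0 rmorph1 oner_neq0 f'0 !(mul0r, invr0, mulr0).
  exists (f * g'), (g * f'); rewrite !rmorphM mulf_neq0 //.
  by split=> //; field; rewrite g0 g'0 f'0.
Qed.

HB.instance Definition _ :=
  GRing.isDivringClosed.Build L frac_pred frac_divring_closed.

Record frac_field := FracElt { frac_val : L; _ : frac_val \in frac_pred }.
HB.instance Definition _ := [isSub for frac_val].
HB.instance Definition _ := [Choice of frac_field by <:].
HB.instance Definition _ := [SubChoice_isSubIntegralDomain of frac_field by <:].
HB.instance Definition _ := [SubIntegralDomain_isSubField of frac_field by <:].

End FracRing.

Lemma corestriction (R E L : nzRingType) (r : {rmorphism R -> L})
    (i : {rmorphism E -> L}) :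
  injective i -> (forall f, exists x, i x = r f) ->
  exists r' : {rmorphism R -> E}, forall f, i (r' f) = r f.
Proof.
move=> i_inj /choice[g gP].
have gB : zmod_morphism g by move=> x y; apply: i_inj; rewrite !rmorphB !gP rmorphB.
have gM : monoid_morphism g.
  by split=> [|x y]; apply: i_inj; rewrite ?gP ?rmorph1 ?rmorphM // !gP.
pose gZ := GRing.isZmodMorphism.Build _ _ g gB.
pose gMM := GRing.isMonoidMorphism.Build _ _ g gM.
by exists (HB.pack g gZ gMM : {rmorphism R -> E}).
Qed.

Lemma exists_image_ring (R : comNzRingType) (L : fieldType) (r : {rmorphism R -> L}) :
  exists (E : comNzRingType) (i : {rmorphism E -> L}) (r' : {rmorphism R -> E}),
    [/\ injective i, forall f, i (r' f) = r f & forall x, exists f, x = r' f].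
Proof.
pose i : {rmorphism image_ring r -> L} := \val.
have i_inj : injective i by apply: val_inj.
have [|r' r'E] := @corestriction _ _ _ r i i_inj.
  move=> f; have rf : r f \in image_pred r by apply/asboolP; exists f.
  by exists (ImageElt rf).
exists _, i, r'; split=> // x; have /asboolP[f xE] := valP x.
by exists f; apply: i_inj; rewrite r'E -xE.
Qed.

Lemma exists_frac_field (R : comNzRingType) (L : fieldType) (r : {rmorphism R -> L}) :
  exists (E : fieldType) (i : {rmorphism E -> L}) (r' : {rmorphism R -> E}),
    (forall f, i (r' f) = r f) /\
    forall x, exists f g, r' g != 0 /\ x = r' f / r' g.
Proof.
pose i : {rmorphism frac_field r -> L} := \val.
have i_inj : injective i by apply: val_inj.
have [|r' r'E] := @corestriction _ _ _ r i i_inj.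
  move=> f; have rf : r f \in frac_pred r.
    by apply/asboolP; exists f, 1; rewrite rmorph1 oner_neq0 divr1.
  by exists (FracElt rf).
exists _, i, r'; split=> // x; have /asboolP[f [g [g0 xE]]] := valP x.
exists f, g; rewrite -(fmorph_eq0 i) r'E; split=> //; apply: i_inj.
by rewrite fmorph_div !r'E -xE.
Qed.

(** * Frobenius derivations along a ring morphism *)

(** A derivation of R with values in S, where R acts on S through r followed by
    the q-th power map. *)
Definition frob_derivation (q : nat) (R S : pzRingType) (r D : R -> S) : Prop :=
  (forall x y, D (x + y) = D x + D y) /\
  (forall x y, D (x * y) = r x ^+ q * D y + r y ^+ q * D x).

Section FrobDerivation.
Variables (q : nat) (R S : comNzRingType) (r : {rmorphism R -> S}) (D : R -> S).
Hypothesis D_der : frob_derivation q r D.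

Lemma frobD x y : D (x + y) = D x + D y. Proof. exact: (proj1 D_der). Qed.
Lemma frobM x y : D (x * y) = r x ^+ q * D y + r y ^+ q * D x.
Proof. exact: (proj2 D_der). Qed.
Lemma frob0 : D 0 = 0.
Proof. by have := frobD 0 0; rewrite addr0 => /(canLR (addrK _)); rewrite subrr. Qed.
Lemma frobB x y : D (x - y) = D x - D y.
Proof. by apply: (canRL (addrK _)); rewrite -frobD subrK. Qed.
Lemma frob1 : D 1 = 0.
Proof.
have := frobM 1 1; rewrite mulr1 rmorph1 expr1n mul1r.
by move=> /(canLR (addrK _)); rewrite subrr.
Qed.
Lemma frob_sum (I : Type) (s : seq I) (P : pred I) (F : I -> R) :
  D (\sum_(i <- s | P i) F i) = \sum_(i <- s | P i) D (F i).
Proof. exact: (big_morph D frobD frob0). Qed.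
Lemma frobX x k : D (x ^+ k) = k%:R * (r x ^+ (q * k.-1) * D x).
Proof.
elim: k => [|k IH]; first by rewrite mul0r expr0 frob1.
rewrite exprS frobM IH; case: k {IH} => [|k] /=.
  by rewrite muln0 !expr0 rmorph1 expr1n !mul0r mulr0 add0r !mul1r.
by rewrite rmorphXn -exprM mulnS exprD [(k.+1 * q)%N]mulnC mulnS exprD -natr1; ring.
Qed.
Lemma frob_pchar p x : p \in [pchar S] -> D (x ^+ p) = 0.
Proof. by move=> pS; rewrite frobX pcharf0 // mul0r. Qed.
End FrobDerivation.

Lemma exprD_pchar_pow (R : comNzRingType) p n (x y : R) :
  p \in [pchar R] -> (x + y) ^+ (p ^ n) = x ^+ (p ^ n) + y ^+ (p ^ n).
Proof.
move=> pR; apply: exprDn_pchar.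
by rewrite pnatX pnatE ?(pcharf_prime pR) ?pR ?orbT.
Qed.

Lemma frob_derivation_comp p n (K N : fieldType) (d : K -> K) (h : {rmorphism K -> N}) :
  Fr_derivation p n d -> frob_derivation (p ^ n) h (h \o d).
Proof.
case=> dD dM; split=> x y /=; first by rewrite dD rmorphD.
by rewrite dM rmorphD !rmorphM !rmorphXn.
Qed.

(** The quotient rule determines D'(x) for x = r f / r g: it is the solution of
    y (r g)^q = D f - x^q D g, which does not depend on f and g. *)
Lemma frac_derivation p n (R : comNzRingType) (k L : fieldType)
    (r : {rmorphism R -> k}) (phi : {rmorphism k -> L}) (D : R -> L) :
  let q := (p ^ n)%N in p \in [pchar L] ->
  (forall x, exists f g, r g != 0 /\ x = r f / r g) ->
  frob_derivation q (phi \o r) D -> (forall f, r f = 0 -> D f = 0) ->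
  exists D' : k -> L, frob_derivation q phi D' /\ forall f, D' (r f) = D f.
Proof.
move=> q charL surj D_der D0.
have Dr f f' : r f = r f' -> D f = D f'.
  move=> ff'; apply/eqP; rewrite -subr_eq0 -(frobB (r := phi \o r) D_der).
  by rewrite D0 // rmorphB ff' subrr.
have DM f g : D (f * g) = phi (r f) ^+ q * D g + phi (r g) ^+ q * D f.
  by case: D_der => _ ->.
have DD f g : D (f + g) = D f + D g by case: D_der.
have /choice[D' D'P] x : exists y, forall f g, r g != 0 -> x * r g = r f ->
    y * phi (r g) ^+ q = D f - phi x ^+ q * D g.
  have [f [g [g0 ->]]] := surj x.
  exists ((D f - phi (r f / r g) ^+ q * D g) / phi (r g) ^+ q) => f' g' g'0 E.
  have {E} E : r (f * g') = r (f' * g) by rewrite !rmorphM -E; field.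
  have := Dr _ _ E; rewrite !DM.
  have -> : phi (r f') = phi (r f) * phi (r g') / phi (r g).
    have : phi (r (f * g')) = phi (r (f' * g)) by rewrite E.
    rewrite !rmorphM => ->; rewrite mulfK ?fmorph_eq0 //.
  rewrite fmorph_div.
  have : phi (r g) != 0 by rewrite fmorph_eq0.
  move: (phi (r f)) (phi (r g)) (phi (r g')) => a b c b0 {}E.
  have bq : b ^+ q != 0 by rewrite expf_neq0.
  move: E; rewrite !expr_div_n !exprMn.
  move: bq; move: (a ^+ q) (b ^+ q) (c ^+ q) => A B C B0 E.
  have E' : C * D f = A * C / B * D g + B * D f' - A * D g'.
    by apply: (canRL (addrK _)); rewrite addrC E; ring.
  transitivity ((C * D f - A * C / B * D g) / B); first by field.
  by rewrite E'; field.
have {D'P} D'P f g x : r g != 0 -> x * r g = r f ->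
    D' x * phi (r g) ^+ q = D f - phi x ^+ q * D g by apply: D'P.
have canc g (a b : L) : r g != 0 -> a * phi (r g) ^+ q = b * phi (r g) ^+ q -> a = b.
  by move=> g0; apply: mulIf; rewrite expf_neq0 // fmorph_eq0.
exists D'; split; last first.
  move=> f; have := D'P f 1 (r f); rewrite rmorph1 mulr1 oner_neq0.
  move=> /(_ isT erefl); rewrite rmorph1 expr1n mulr1 => ->.
  by rewrite (frob1 (r := phi \o r) D_der) mulr0 subr0.
have powD (x y : L) : (x + y) ^+ q = x ^+ q + y ^+ q by apply: exprD_pchar_pow.
split=> x y; have [f [g [g0 xE]]] := surj x; have [f' [g' [g'0 yE]]] := surj y;
  have gg'0 : r (g * g') != 0 by [rewrite rmorphM mulf_neq0];
  have Ex : x * r g = r f by [rewrite xE divfK];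
  have Ey : y * r g' = r f' by [rewrite yE divfK];
  have Hx := D'P _ _ _ g0 Ex; have Hy := D'P _ _ _ g'0 Ey; apply: (canc _ _ _ gg'0).
- rewrite (D'P (f * g' + f' * g)) //; last by rewrite rmorphD !rmorphM -Ex -Ey; ring.
  transitivity (D' x * phi (r g) ^+ q * phi (r g') ^+ q +
    D' y * phi (r g') ^+ q * phi (r g) ^+ q); last by rewrite !rmorphM exprMn; ring.
  by rewrite Hx Hy DD !DM rmorphD powD -Ex -Ey !rmorphM !exprMn; ring.
- rewrite (D'P (f * f')) //; last by rewrite !rmorphM -Ex -Ey; ring.
  transitivity (phi x ^+ q * phi (r g) ^+ q * (D' y * phi (r g') ^+ q) +
    phi y ^+ q * phi (r g') ^+ q * (D' x * phi (r g) ^+ q)).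
    by rewrite Hx Hy !DM -Ex -Ey !rmorphM !exprMn; ring.
  by rewrite !rmorphM !exprMn; ring.
Qed.

Lemma mmap_monom m (K S : comNzRingType) (f : {additive K -> S}) (h : 'I_m -> S) c a :
  mmap f h (c *: 'X_[a]) = f c * mmap1 h a.
Proof.
have [->|c0] := eqVneq c 0; first by rewrite scale0r mmap0 raddf0 mul0r.
by rewrite /mmap msuppMCX // big_seq1 mcoeffZ mcoeffX eqxx mulr1.
Qed.

Lemma mmap1_exp m (S : comNzRingType) (z : 'I_m -> S) k a :
  mmap1 (fun i => z i ^+ k) a = mmap1 z a ^+ k.
Proof. by rewrite /mmap1 -prodrXl; apply: eq_bigr => i _; rewrite exprAC. Qed.

Section PolyDerivation.
Variables (p n : nat) (K S : comNzRingType) (phi : {rmorphism K -> S}) (D : K -> S).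
Hypotheses (charS : p \in [pchar S]) (D_der : frob_derivation (p ^ n) phi D).
Let q := (p ^ n)%N.

Let D_zmod : zmod_morphism D. Proof. exact: frobB D_der. Qed.
Let Dadd : {additive K -> S} :=
  HB.pack D (GRing.isZmodMorphism.Build K S D D_zmod).

Let powD (x y : S) : (x + y) ^+ q = x ^+ q + y ^+ q.
Proof. exact: exprD_pchar_pow. Qed.
Let pow0 : (0 : S) ^+ q = 0.
Proof. by rewrite expr0n gtn_eqF // expn_gt0 (prime_gt0 (pcharf_prime charS)). Qed.

(** The product rule is additive in each argument, since the q-th power map is
    additive in characteristic p; it suffices to check it on generators. *)
Lemma frob_derivation_bilinear (R : comNzRingType) (r : {rmorphism R -> S})
    (T : R -> S) (G : R -> Prop) :
  (forall x y, T (x + y) = T x + T y) ->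
  (forall P : R -> Prop, P 0 -> (forall x y, G x -> P y -> P (x + y)) ->
     forall x, P x) ->
  (forall x y, G x -> G y -> T (x * y) = r x ^+ q * T y + r y ^+ q * T x) ->
  frob_derivation q r T.
Proof.
move=> TD ind TM; split=> //.
have T0 : T 0 = 0.
  by have := TD 0 0; rewrite addr0 => /(canLR (addrK _)); rewrite subrr.
have ind' := ind; apply: ind => [y|x x' Gx IH y].
  by rewrite mul0r T0 rmorph0 pow0 mul0r mulr0 addr0.
rewrite mulrDl (TD (x * y)) IH rmorphD powD (TD x).
suff -> : T (x * y) = r x ^+ q * T y + r y ^+ q * T x by ring.
move: y; apply: ind' => [|y y' Gy IHy].
  by rewrite mulr0 T0 rmorph0 pow0 mul0r mulr0 addr0.
by rewrite mulrDr (TD (x * y)) IHy rmorphD powD (TD y) TM //; ring.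
Qed.

Section MPoly.
Variables (m : nat) (z : 'I_m -> S).

Let zq i := z i ^+ q.

Lemma mmap_frobC c : mmap D zq c%:MP = D c.
Proof. by rewrite (mmapC _ Dadd). Qed.

Lemma mmap_frobX i : mmap D zq 'X_i = 0.
Proof.
by rewrite -[X in mmap _ _ X]scale1r (mmap_monom Dadd) /= (frob1 D_der) mul0r.
Qed.

Lemma mmap_frob_derivation :
  frob_derivation q (mmap phi z) (mmap D zq).
Proof.
pose G (f : {mpoly K[m]}) := exists c a, f = c *: 'X_[a].
apply: (frob_derivation_bilinear (r := mmap phi z) (G := G)).
- exact: (raddfD (mmap Dadd zq)).
- move=> P P0 PD f; elim/mpolyind: f => // c a f _ _ Pf.
  by apply: PD => //; exists c, a.
move=> _ _ [c [a ->]] [c' [a' ->]].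
rewrite -scalerAl -scalerAr scalerA -mpolyXD !(mmap_monom Dadd) /= !mmapZ !mmapX.
rewrite commr_mmap1_M ?(proj2 D_der); last by move=> i x; apply: mulrC.
by rewrite !mmap1_exp !exprMn; ring.
Qed.

Variable b : 'I_m -> S.

(** The value of the prolongation of f at the point (z, b), for coefficients in
    K differentiated by D. *)
Definition mprolong (f : {mpoly K[m]}) : S :=
  mmap D zq f + \sum_(i < m) mmap phi z f^`M(i) ^+ q * b i.

Lemma mprolong_frob_derivation : frob_derivation q (mmap phi z) mprolong.
Proof.
have [TD TM] := mmap_frob_derivation.
split=> f g; rewrite /mprolong.
  rewrite TD addrACA -big_split /=; congr (_ + _); apply: eq_bigr => i _.
  by rewrite mderivD rmorphD powD mulrDl.
rewrite TM !mulrDr addrACA !mulr_sumr -big_split /=; congr (_ + _).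
apply: eq_bigr => i _.
by rewrite mderivM rmorphD powD !rmorphM !exprMn; ring.
Qed.

Lemma mprolongC c : mprolong c%:MP = D c.
Proof.
rewrite /mprolong mmap_frobC big1 ?addr0 // => i _.
by rewrite mderivC rmorph0 pow0 mul0r.
Qed.

Lemma mprolongX i : mprolong 'X_i = b i.
Proof.
rewrite /mprolong mmap_frobX add0r (bigD1 i) //= mderivX mnm1E eqxx scale1r.
rewrite -[X in mnm_sub X _]add0m addmK mmapX mmap11.
rewrite expr1n mul1r big1 ?addr0 // => j ji.
by rewrite mderivX mnm1E eq_sym (negbTE ji) scale0r rmorph0 pow0 mul0r.
Qed.

Lemma frob_derivation_mpoly_unique (T : {mpoly K[m]} -> S) :
  frob_derivation q (mmap phi z) T ->
  (forall c, T c%:MP = D c) -> (forall i, T 'X_i = b i) -> T =1 mprolong.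
Proof.
move=> T_der TC TX f.
have [TD TM] := T_der; have [PD PM] := mprolong_frob_derivation.
have T1 := frob1 (r := mmap phi z) T_der.
have P1 := frob1 (r := mmap phi z) mprolong_frob_derivation.
pose G g := T g = mprolong g.
have GM g g' : G g -> G g' -> G (g * g') by rewrite /G TM PM => -> ->.
have GX a : G 'X_[a].
  rewrite mpolyXE_id; elim/big_ind: _ => //; first by rewrite /G T1 P1.
  move=> i _; elim: (a i) => [|k IH]; first by rewrite expr0 /G T1 P1.
  by rewrite exprS; apply: GM => //; rewrite /G TX mprolongX.
elim/mpolyind: f => [|c a f _ _ IH].
  by rewrite (frob0 (r := mmap phi z) T_der)
             (frob0 (r := mmap phi z) mprolong_frob_derivation).
rewrite TD PD IH -mul_mpolyC; congr (_ + _); apply: GM => //.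
by rewrite /G TC mprolongC.
Qed.
End MPoly.

End PolyDerivation.

(** * Extending a Frobenius derivation along a separable extension *)

(** If x^p = c lies in E but x does not, then X^p - c is irreducible over E: a
    common divisor of it and P is, over L, a power (X - x)^k, and for 0 < k < p its
    coefficient of degree k - 1, which is - k x up to a scalar, would put x in E. *)
Lemma purely_insep_dvdp (p : nat) (E L : fieldType) (i : {rmorphism E -> L})
    (c : E) (x : L) (P : {poly E}) :
  p \in [pchar L] -> i c = x ^+ p -> (forall e, i e <> x) ->
  root (map_poly i P) x -> 'X^p - c%:P %| P.
Proof.
move=> charL cx xE Px.
have p_prime := pcharf_prime charL; have p0 := prime_gt0 p_prime.
set Q := 'X^p - c%:P; pose g := gcdp P Q.
have QE : map_poly i Q = ('X - x%:P) ^+ p.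
  rewrite rmorphB /= map_polyXn map_polyC /= cx.
  have charP : p \in [pchar {poly L}] by rewrite pchar_poly.
  have := pFrobenius_autB_comm charP (mulrC 'X x%:P : GRing.comm 'X x%:P).
  by rewrite !pFrobenius_autE -rmorphXn => <-.
have gQ : map_poly i g %| ('X - x%:P) ^+ p.
  by rewrite -QE dvdp_map dvdp_gcdr.
have [k kp /eqp_eq gE] := dvdp_exp_XsubCP gQ.
rewrite (monicP (monic_exp _ (monicXsubC x))) scale1r lead_coef_map in gE.
have Q0 : Q != 0 by rewrite -size_poly_gt0 size_XnsubC.
have g0 : g != 0 by rewrite gcdp_eq0 negb_and Q0 orbT.
have sg : size g = k.+1.
  by rewrite -(size_map_poly i) gE size_scale ?size_exp_XsubC // fmorph_eq0 lead_coef_eq0.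
have gx : root (map_poly i g) x.
  by rewrite gcdp_map root_gcd Px QE -(prednK p0) root_exp_XsubC eqxx.
have k0 : (0 < k)%N.
  case: k {kp sg} gE => // gE; move: gx; rewrite gE expr0 rootE hornerZ hornerC.
  by rewrite mulr1 fmorph_eq0 lead_coef_eq0 (negbTE g0).
have [kltp|] := ltnP k p; last first.
  move=> pk; apply: dvdp_trans (dvdp_gcdl P Q).
  have : g %= Q.
    by rewrite -dvdp_size_eqp ?dvdp_gcdr // sg size_XnsubC // eqSS eqn_leq kp.
  by rewrite eqp_sym => /andP[].
have := congr1 (fun f : {poly L} => f`_k.-1) gE.
have coef_k : (('X - x%:P) ^+ k)`_k.-1 = - (k%:R * x).
  have := @coefPn_prod_XsubC L (nseq k x); rewrite size_nseq !big_nseq iter_mulr_1.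
  by rewrite iter_addr_0 mulr_natl => ->; rewrite ?size_nseq -?lt0n.
rewrite coef_map coefZ coef_k => E'.
have kL : k%:R != 0 :> L.
  by rewrite -(dvdn_pcharf charL); apply: contraTN kltp => /dvdn_leq-/(_ k0); rewrite leqNgt.
case: (xE (- g`_k.-1 / (lead_coef g * k%:R))).
rewrite fmorph_div rmorphN rmorphM rmorph_nat E'.
have lg : i (lead_coef g) != 0 by rewrite fmorph_eq0 lead_coef_eq0.
field. by rewrite kL lg.
Qed.

Definition lin_free (k L : fieldType) (phi : k -> L) r (x : 'I_r -> L) : Prop :=
  forall c : 'I_r -> k, \sum_t phi (c t) * x t = 0 -> forall t, c t = 0.

Definition pow_lin_free (p : nat) (k L : fieldType) (phi : k -> L) : Prop :=
  forall r (x : 'I_r -> L), lin_free phi x -> lin_free phi (fun t => x t ^+ p).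

(** Linear disjointness from the p-th roots of k, used in the overfield of L
    which is L itself embedded by the Frobenius map: there the p-th root of c is c. *)
Lemma separable_pow_lin_free p (k L : fieldType) (phi : {rmorphism k -> L}) :
  p \in [pchar L] -> separable_ext p phi -> pow_lin_free p phi.
Proof.
move=> charL sep r x xfree c cx t.
pose j : {rmorphism L -> L} := pFrobenius_aut charL.
apply/eqP; rewrite -(fmorph_eq0 phi); apply/eqP.
apply: (sep L j r x xfree (fun t => phi (c t))) => [u|].
  by exists (c u); rewrite /j /= pFrobenius_autE.
by rewrite -[RHS]cx; apply: eq_bigr => u _; rewrite /j /= pFrobenius_autE.
Qed.

Section SeparableExtension.
Variables (p n : nat) (k L : fieldType) (phi : {rmorphism k -> L}) (D : k -> L).
Let q := (p ^ n)%N.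
Hypotheses (charL : p \in [pchar L]) (D_der : frob_derivation q phi D).
Hypothesis phi_sep : pow_lin_free p phi.

Let powD (x y : L) : (x + y) ^+ p = x ^+ p + y ^+ p.
Proof. by have := @exprD_pchar_pow L p 1 x y charL; rewrite expn1. Qed.
Let powqD (x y : L) : (x + y) ^+ q = x ^+ q + y ^+ q.
Proof. exact: exprD_pchar_pow. Qed.
Let p_gt0 : (0 < p)%N. Proof. exact: prime_gt0 (pcharf_prime charL). Qed.
Let q_gt0 : (0 < q)%N. Proof. by rewrite expn_gt0 p_gt0. Qed.

Lemma pow_sum I (s : seq I) (P : pred I) (F : I -> L) :
  (\sum_(i <- s | P i) F i) ^+ p = \sum_(i <- s | P i) F i ^+ p.
Proof.
by apply: (big_morph (fun x => x ^+ p)) => //; rewrite expr0n gtn_eqF.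
Qed.
Lemma powq_sum I (s : seq I) (P : pred I) (F : I -> L) :
  (\sum_(i <- s | P i) F i) ^+ q = \sum_(i <- s | P i) F i ^+ q.
Proof.
by apply: (big_morph (fun x => x ^+ q)) => //; rewrite expr0n gtn_eqF.
Qed.

(** This makes sum c_t x_t^p |-> sum D(c_t) x_t^(pq) well defined on k L^p. If
    the x_t are linearly independent, so are their p-th powers and all the c_t
    vanish; otherwise one x_t is a combination of the others and can be
    eliminated, because D kills p-th powers. *)
Lemma derivation_pow_relation r (x : 'I_r -> L) (c : 'I_r -> k) :
  \sum_t phi (c t) * x t ^+ p = 0 -> \sum_t D (c t) * (x t ^+ p) ^+ q = 0.
Proof.
elim: r x c => [|r IH] x c cx; first by rewrite big_ord0.
have [xfree|/existsNP[u /not_implyP[ux /existsNP[t0 /eqP ut0]]]] := EM (lin_free phi x).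
  rewrite big1 // => t _.
  by rewrite (phi_sep xfree cx) (frob0 D_der) mul0r.
pose v t := - u (lift t0 t) / u t0.
have xE : x t0 = \sum_t phi (v t) * x (lift t0 t).
  move: ux; rewrite (bigD1_ord t0) //= => /eqP; rewrite addr_eq0 => /eqP ux.
  apply: (@mulfI _ (phi (u t0))); first by rewrite fmorph_eq0.
  rewrite ux mulr_sumr -sumrN; apply: eq_bigr => t _.
  by rewrite fmorph_div rmorphN; field; rewrite fmorph_eq0.
have charK : p \in [pchar k] by rewrite -(fmorph_pchar phi).
pose c' t := c (lift t0 t) + c t0 * v t ^+ p.
have := IH (fun t => x (lift t0 t)) c'; rewrite (bigD1_ord t0) //= in cx *.
rewrite (bigD1_ord t0) //= xE.
have -> : \sum_t phi (c' t) * x (lift t0 t) ^+ p =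
    phi (c t0) * x t0 ^+ p + \sum_t phi (c (lift t0 t)) * x (lift t0 t) ^+ p.
  rewrite xE pow_sum mulr_sumr -big_split; apply: eq_bigr => t _ /=.
  by rewrite rmorphD rmorphM rmorphXn exprMn; ring.
move=> /(_ cx) E; rewrite -[RHS]E pow_sum powq_sum mulr_sumr -big_split.
apply: eq_bigr => t _ /=.
rewrite (frobD D_der) (frobM D_der) (frob_pchar D_der _ charL) mulr0 add0r.
by rewrite rmorphXn !exprMn; ring.
Qed.

End SeparableExtension.

Lemma mul_comm_rmorph (R S : comNzRingType) (i : {rmorphism R -> S}) x :
  commr_rmorph i x.
Proof. by move=> e; apply: mulrC. Qed.

Section PolyDer.
Variables (p n : nat) (E L : fieldType) (i : {rmorphism E -> L}) (D : E -> L).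
Let q := (p ^ n)%N.
Hypotheses (charL : p \in [pchar L]) (D_der : frob_derivation q i D).
Variable x : L.

Let r : {rmorphism {poly E} -> L} := horner_morph (mul_comm_rmorph i x).

Let D_zmod : zmod_morphism D. Proof. exact: frobB D_der. Qed.
Let Dadd : {additive E -> L} := HB.pack D (GRing.isZmodMorphism.Build E L D D_zmod).

Definition poly_der (P : {poly E}) : L := (map_poly D P).[x ^+ q].

Lemma poly_der_monom c a : poly_der (c *: 'X^a) = D c * x ^+ (q * a).
Proof.
rewrite /poly_der; have -> : map_poly D (c *: 'X^a) = D c *: 'X^a.
  apply/polyP => j; rewrite (coef_map Dadd) !coefZ !coefXn /=.
  by case: eqP; rewrite ?mulr1 ?mulr0 ?(frob0 D_der).
by rewrite hornerZ hornerXn exprM.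
Qed.

Lemma poly_der_frob : frob_derivation q r poly_der.
Proof.
pose G (f : {poly E}) := exists c a, f = c *: 'X^a.
apply: (@frob_derivation_bilinear p n L charL _ r poly_der G).
- by move=> f g; rewrite /poly_der (raddfD (map_poly Dadd)) hornerD.
- move=> P P0 PD f; rewrite -[f]coefK poly_def.
  by apply: (big_rec P) => // j g _ Pg; apply: PD => //; exists f`_j, j.
move=> _ _ [c [a ->]] [c' [a' ->]].
rewrite -scalerAl -scalerAr scalerA -exprD !poly_der_monom (frobM D_der).
rewrite /r /= /horner_morph !linearZ /= !map_polyXn !hornerZ !hornerXn.
by rewrite mulnDr exprD !exprMn -!exprM ![(_ * q)%N]mulnC; ring.
Qed.
End PolyDer.

(** An intermediate field of L / L^p, with a derivation that vanishes on L^p as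
    every derivation of L must. *)
Definition insep_stage p n (E L : fieldType) (i : {rmorphism E -> L}) (D : E -> L) :
    Prop :=
  [/\ frob_derivation (p ^ n) i D, forall x, exists e, i e = x ^+ p
    & forall e x, i e = x ^+ p -> D e = 0].

(** For x outside E, put D(x) = 0: the relations of x over E are the multiples
    of X^p - x^p, and D(x^p) = 0. *)
Lemma insep_stage_adjoin p n (E L : fieldType) (i : {rmorphism E -> L}) (D : E -> L)
    (x : L) :
  p \in [pchar L] -> insep_stage p n i D ->
  exists (E1 : fieldType) (i1 : {rmorphism E1 -> L}) (D1 : E1 -> L),
    [/\ insep_stage p n i1 D1, forall e, exists e1, i1 e1 = i e /\ D1 e1 = D e
      & exists e1, i1 e1 = x].
Proof.
move=> charL st; have [D_der Ep D0] := st.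
have [xE|/forallNP xE] := EM (exists e, i e = x).
  by exists E, i, D; split=> // e; exists e.
pose r : {rmorphism {poly E} -> L} := horner_morph (mul_comm_rmorph i x).
have T_der : frob_derivation (p ^ n) r (poly_der p n D x) by apply: poly_der_frob.
have [E1 [i1 [r' [r'E surj]]]] := exists_frac_field r.
have [c cx] := Ep x.
have [||D1 [D1_der D1E]] := @frac_derivation p n _ _ _ r' i1 (poly_der p n D x) charL surj.
- by case: T_der => TD TM; split=> // f g; rewrite TM /= !r'E.
- move=> f /(congr1 i1); rewrite r'E rmorph0 => f0.
  have /dvdpP[g ->] := purely_insep_dvdp charL cx xE (introT eqP f0).
  have rQ : r ('X^p - c%:P) = 0.
    rewrite rmorphB rmorphXn /r /= /horner_morph map_polyX map_polyC hornerX hornerC.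
    by rewrite /= cx subrr.
  rewrite (frobM T_der) rQ (frobB T_der) -['X^p]scale1r -[c%:P]mulr1 mul_polyC -(expr0 'X).
  rewrite !(poly_der_monom D_der) (frob1 D_der) (D0 c x cx).
  by rewrite expr0n gtn_eqF ?expn_gt0 ?(prime_gt0 (pcharf_prime charL)) //
    !(mul0r, mulr0, addr0, subrr).
have D1i e : i1 (r' e%:P) = i e /\ D1 (r' e%:P) = D e.
  rewrite r'E /r /= /horner_morph map_polyC hornerC; split=> //.
  by rewrite D1E -[_%:P]mulr1 mul_polyC -(expr0 'X) (poly_der_monom D_der) muln0 mulr1.
exists E1, i1, D1; split.
- split=> //.
    by move=> y; have [e <-] := Ep y; exists (r' e%:P); case: (D1i e).
  move=> e1 y e1y; have [e ey] := Ep y; have [i1e D1e] := D1i e.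
  have -> : e1 = r' e%:P by apply: (fmorph_inj i1); rewrite e1y -ey i1e.
  by rewrite D1e (D0 e y).
- by move=> e; exists (r' e%:P).
- by exists (r' 'X); rewrite r'E /r /= /horner_morph map_polyX hornerX.
Qed.

Lemma insep_stage_adjoins p n (E L : fieldType) (i : {rmorphism E -> L}) (D : E -> L)
    (xs : seq L) :
  p \in [pchar L] -> insep_stage p n i D ->
  exists (E1 : fieldType) (i1 : {rmorphism E1 -> L}) (D1 : E1 -> L),
    [/\ insep_stage p n i1 D1, forall e, exists e1, i1 e1 = i e /\ D1 e1 = D e
      & forall x, x \in xs -> exists e1, i1 e1 = x].
Proof.
move=> charL; elim: xs E i D => [|x xs IH] E i D st.
  by exists E, i, D; split=> // e; exists e.
have [E1 [i1 [D1 [st1 H1 [e1 e1x]]]]] := insep_stage_adjoin x charL st.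
have [E2 [i2 [D2 [st2 H2 xs2]]]] := IH _ _ _ st1.
exists E2, i2, D2; split=> //.
  move=> e; have [e' [<- <-]] := H1 e; exact: H2.
move=> y; rewrite inE => /orP[/eqP ->|]; last exact: xs2.
by have [e2 [e2E _]] := H2 e1; exists e2; rewrite e2E.
Qed.

(** Since L is generated over k by B, the derivation extends first to the field
    k(B^p), which contains L^p, and then to the elements of B one at a time. *)
Lemma separable_derivation_extension p n (k L : fieldType) (phi : {rmorphism k -> L})
    (D : k -> L) m (B : 'I_m -> L) :
  p \in [pchar L] -> pow_lin_free p phi -> frob_derivation (p ^ n) phi D ->
  (forall x, exists f g, mmap phi B g != 0 /\ x = mmap phi B f / mmap phi B g) ->
  exists D' : L -> L,
    frob_derivation (p ^ n) idfun D' /\ forall c, D' (phi c) = D c.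
Proof.
move=> charL phi_sep D_der gen.
(* The field k(B^p) as the field of fractions of the image of r. *)
pose r : {rmorphism {mpoly k[m]} -> L} := mmap phi (fun j => B j ^+ p).
pose T := mmap D (fun j => (B j ^+ p) ^+ (p ^ n)).
have T_der : frob_derivation (p ^ n) r T by apply: mmap_frob_derivation.
have [E [i [r' [r'E surj]]]] := exists_frac_field r.
have [||DE [DE_der DEE]] := @frac_derivation p n _ _ _ r' i T charL surj.
- by case: T_der => TD TM; split=> // f g; rewrite TM /= !r'E.
- move=> f /(congr1 i); rewrite r'E rmorph0 => f0; pose s := msupp f.
  have := derivation_pow_relation charL D_der phi_sep
    (x := fun t : 'I_(size s) => mmap1 B (nth 0%MM s t))
    (c := fun t => f@_(nth 0%MM s t)).
  rewrite -(big_mkord xpredT (fun t => phi f@_(nth 0%MM s t) * mmap1 B (nth 0%MM s t) ^+ p)).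
  rewrite -(big_mkord xpredT
    (fun t => D f@_(nth 0%MM s t) * (mmap1 B (nth 0%MM s t) ^+ p) ^+ (p ^ n))).
  rewrite -(big_nth 0%MM xpredT (fun a => phi f@_a * mmap1 B a ^+ p)).
  rewrite -(big_nth 0%MM xpredT (fun a => D f@_a * (mmap1 B a ^+ p) ^+ (p ^ n))).
  rewrite /T /mmap => H; rewrite -[RHS]H.
    by apply: eq_bigr => a _; rewrite !mmap1_exp.
  by rewrite -[RHS]f0; apply: eq_bigr => a _; rewrite mmap1_exp.
have iC c : i (r' c%:MP) = phi c by rewrite r'E /r /= mmapC.
have DC c : DE (r' c%:MP) = D c.
  by rewrite DEE /T (mmap_frobC D_der).
have st : insep_stage p n i DE.
  pose P (y : L) := exists e, i e = y ^+ p /\ DE e = 0.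
  have Pf f : P (mmap phi B f).
    have PM y z : P y -> P z -> P (y * z).
      move=> [e [ey De]] [e' [ez De']]; exists (e * e').
      by rewrite rmorphM exprMn ey ez (frobM DE_der) De De' !mulr0 addr0.
    have PD y z : P y -> P z -> P (y + z).
      move=> [e [ey De]] [e' [ez De']]; exists (e + e').
      have := @exprD_pchar_pow L p 1 y z charL; rewrite expn1 => ->.
      by rewrite rmorphD ey ez (frobD DE_der) De De' addr0.
    have PC c : P (phi c).
      exists (r' (c ^+ p)%:MP); rewrite iC rmorphXn; split=> //.
      by rewrite DC (frob_pchar D_der).
    have PX a : P (mmap1 B a).
      rewrite /mmap1; elim/big_ind: _ => //; first by rewrite -(rmorph1 phi).
      move=> j _; elim: (a j) => [|k' IH]; first by rewrite expr0 -(rmorph1 phi).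
      rewrite exprS; apply: PM => //; exists (r' 'X_j); split.
        by rewrite r'E /r /= mmapX mmap1U.
      by rewrite DEE /T (mmap_frobX D_der).
    rewrite /mmap; elim/big_ind: _ => //; first by rewrite -(rmorph0 phi).
    by move=> a _; apply: PM.
  have Px x : P x.
    have [f [g [g0 ->]]] := gen x; have [e [ef De]] := Pf f; have [e' [eg De']] := Pf g.
    have e'0 : i e' != 0 by rewrite eg expf_neq0.
    exists (e / e'); rewrite fmorph_div ef eg expr_div_n; split=> //.
    have := frobM DE_der (e / e') e'; rewrite divfK -?(fmorph_eq0 i) // De De'.
    rewrite mulr0 add0r => /esym/eqP; rewrite mulf_eq0 expf_eq0 (negbTE e'0) andbF.
    by move=> /eqP.
  split=> //; first by move=> x; have [e [ex _]] := Px x; exists e.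
  move=> e x ex; have [e' [e'x <-]] := Px x; congr DE.
  by apply: (fmorph_inj i); rewrite ex e'x.
have [E1 [i1 [D1 [st1 H1 B1]]]] := insep_stage_adjoins (codom B) charL st.
have i1_surj x : exists e, i1 e = x.
  have i1M y z : (exists e, i1 e = y) -> (exists e, i1 e = z) -> exists e, i1 e = y * z.
    by move=> [e <-] [e' <-]; exists (e * e'); rewrite rmorphM.
  have i1f f : exists e, i1 e = mmap phi B f.
    rewrite /mmap; elim/big_ind: _ => [|_ _ [e <-] [e' <-]|a _].
    - by exists 0; rewrite rmorph0.
    - by exists (e + e'); rewrite rmorphD.
    apply: (i1M _ _).
      by have [e1 [e1E _]] := H1 (r' (f@_a)%:MP); exists e1; rewrite e1E iC.
    rewrite /mmap1; elim/big_ind: _ => [|y z|j _].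
    - by exists 1; rewrite rmorph1.
    - exact: i1M.
    have [e <-] := B1 (B j) (codom_f B j); exists (e ^+ a j); exact: rmorphXn.
  have [f [g [g0 ->]]] := gen x; have [[e <-] [e' <-]] := (i1f f, i1f g).
  by exists (e / e'); rewrite fmorph_div.
have [g gP] := choice i1_surj.
exists (fun x => D1 (g x)); case: st1 => D1_der _ _; split.
  split=> x y.
    by rewrite -(frobD D1_der); congr D1; apply: (fmorph_inj i1); rewrite rmorphD !gP.
  have := frobM D1_der (g x) (g y); rewrite !gP => <-; congr D1.
  by apply: (fmorph_inj i1); rewrite rmorphM !gP.
move=> c; have [e1 [i1e D1e]] := H1 (r' c%:MP).
by rewrite -DC -D1e; congr D1; apply: (fmorph_inj i1); rewrite gP i1e iC.
Qed.

(** * Hilbert's basis theorem *)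

Lemma nat_min_tail (u : nat -> nat) N :
  exists2 i, (N <= i)%N & forall j, (N <= j)%N -> (u i <= u j)%N.
Proof.
pose P v := `[< exists2 i, (N <= i)%N & u i = v >].
have Pex : exists v, P v by exists (u N); apply/asboolP; exists N.
case: (ex_minnP Pex) => _ /asboolP[i Ni <-] H; exists i => // j Nj.
by apply: H; apply/asboolP; exists j.
Qed.

(** Choose successively positions at which the rest of the sequence attains its
    minimum. *)
Lemma nat_monotone_subseq (u : nat -> nat) :
  exists2 s : nat -> nat, {homo s : i j / (i < j)%N} & {homo u \o s : i j / (i <= j)%N}.
Proof.
have /choice[pick pickP] N : exists i, (N <= i)%N /\ forall j, (N <= j)%N -> (u i <= u j)%N.
  by have [i] := nat_min_tail u N; exists i.
pose s := fix s k := if k is k'.+1 then pick (s k').+1 else pick 0%N.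
have sS k : (s k < s k.+1)%N by case: (pickP (s k).+1).
exists s; first exact: homo_ltn ltn_trans sS.
apply: homo_leq => [//|y x z|k]; first exact: leq_trans.
have [N sN] : exists N, s k = pick N /\ (N <= s k)%N.
  by case: k => [|k]; [exists 0%N|exists (s k).+1]; split=> //; case: (pickP (s k).+1).
case: sN => sk Nk; rewrite /= [in leqLHS]sk; case: (pickP N) => _; apply.
by apply: leq_trans Nk (ltnW (sS k)).
Qed.

(** Dickson's lemma. *)
Lemma mnm_wqo m (u : nat -> 'X_{1..m}) : exists i j, (i < j)%N /\ (u i <= u j)%MM.
Proof.
have [s s_lt s_mon] : exists2 s : nat -> nat, {homo s : i j / (i < j)%N} &
    forall c, c \in enum 'I_m -> {homo (fun k => u (s k) c) : i j / (i <= j)%N}.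
  elim: (enum 'I_m) => [|c l [s s_lt s_mon]]; first by exists id.
  have [t t_lt t_mon] := nat_monotone_subseq (fun k => u (s k) c).
  exists (s \o t) => [i j /t_lt/s_lt //|c']; rewrite inE => /orP[/eqP -> //|c'l] i j ij.
  by apply: s_mon => //; apply: ltnW_homo t_lt i j ij.
exists (s 0%N), (s 1%N); split; first exact: s_lt.
by apply/mnm_lepP => c; apply: (s_mon c (mem_enum _ _) 0%N 1%N).
Qed.

Section Hilbert.
Variables (K : fieldType) (m : nat).
Local Notation ideal_of s := (ideal_gen (fun g : {mpoly K[m]} => g \in s)).

Lemma ideal_gen_is_ideal (S : {mpoly K[m]} -> Prop) : is_ideal (ideal_gen S).
Proof.
split=> [I [] //|f g If Ig I I_id SI|f g Ig I I_id SI]; case: (I_id) => I0 ID IM.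
  by apply: ID; [apply: If|apply: Ig].
by apply: IM; apply: Ig.
Qed.

Lemma mlead_cancel (f g : {mpoly K[m]}) :
  mlead f = mlead g -> mleadc f = mleadc g -> f - g != 0 ->
  (mlead (f - g) < mlead f)%O.
Proof.
move=> fg cfg fg0; rewrite Order.POrderTheory.lt_neqAle; apply/andP; split.
  apply: contraNneq fg0 => E; rewrite -mleadc_eq0 E mcoeffB {2}fg cfg subrr //.
by apply: Order.POrderTheory.le_trans (mleadB_le _ _) _; rewrite -fg Order.JoinTheory.joinxx.
Qed.

(** Otherwise there is an infinite sequence in I whose k-th term is not in the
    ideal of the previous ones and has the smallest possible leading monomial. By
    Dickson's lemma some leading monomial divides a later one, and subtracting a
    multiple of the earlier polynomial contradicts the minimality of the later. *)
Lemma hilbert_basis (I : {mpoly K[m]} -> Prop) :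
  is_ideal I -> exists s : seq {mpoly K[m]},
    (forall f, f \in s -> I f) /\ forall f, I f -> ideal_of s f.
Proof.
move=> I_id; have [I0 ID IM] := I_id; apply: contrapT => /forallNP nofin.
have /choice[F FP] (s : seq {mpoly K[m]}) : exists f, (forall f, f \in s -> I f) ->
    [/\ I f, ~ ideal_of s f & forall g, I g -> ~ ideal_of s g ->
       ~~ (mlead g < mlead f)%O].
  have [sI|] := EM (forall f, f \in s -> I f); last by exists 0.
  have [f If sf] : exists2 f, I f & ~ ideal_of s f.
    apply: contrapT => H; apply: (nofin s); split=> // f If.
    by apply: contrapT => sf; apply: H; exists f.
  pose P (a : 'X_{1..m}) := forall f, I f -> ~ ideal_of s f -> mlead f = a ->
    exists f, [/\ I f, ~ ideal_of s f &
      forall g, I g -> ~ ideal_of s g -> ~~ (mlead g < mlead f)%O].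
  suff /(_ (mlead f) f If sf erefl)[f' f'P] : forall a, P a by exists f'.
  apply: (well_founded_ind (@ltom_wf m)) => a IH {}f {}If {}sf fa.
  have [[g [Ig sg gf]]|H] := EM (exists g, [/\ I g, ~ ideal_of s g & (mlead g < mlead f)%O]).
    by apply: (IH (mlead g) _ g) => //; rewrite -fa.
  exists f; split=> // g Ig sg; apply/negP => gf; apply: H; by exists g.
pose S := fix S k := if k is k'.+1 then F (S k') :: S k' else [::].
have SI k f : f \in S k -> I f.
  elim: k f => [|k IH] f //=; rewrite inE => /orP[/eqP ->|/IH //].
  by case: (FP (S k)).
have [i [j [ij uij]]] := mnm_wqo (fun k => mlead (F (S k))).
have fiS : F (S i) \in S j.
  elim: j ij {uij} => // j IH; rewrite ltnS leq_eqVlt /= inE.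
  by case/orP=> [/eqP ->|/IH ->]; rewrite ?eqxx ?orbT.
have [Ifi nfi _] := FP _ (SI i); have [Ifj nfj minj] := FP _ (SI j).
set fi := F (S i) in Ifi nfi uij fiS; set fj := F (S j) in Ifj nfj minj uij.
have [Z0 ZD ZM] := ideal_gen_is_ideal (fun g => g \in S j).
have n0 k : F (S k) != 0.
  apply/eqP => E; have [_ H _] := FP _ (SI k); apply: H; rewrite E => J [] //.
pose h := (mleadc fj / mleadc fi) *: 'X_[(mlead fj - mlead fi)%MM] * fi.
have hS : ideal_of (S j) h by apply: ZM => J _; apply.
have c0 : mleadc fj / mleadc fi != 0.
  by rewrite mulf_neq0 ?invr_eq0 // mleadc_eq0; apply: n0.
have nfh : ~ ideal_of (S j) (fj - h).
  by move=> H; apply: nfj; rewrite -(subrK h fj); apply: ZD.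
have fh0 : fj - h != 0 by apply/eqP => E; apply: nfh; rewrite E.
have X0 : (mleadc fj / mleadc fi) *: 'X_[K, (mlead fj - mlead fi)%MM] != 0.
  by rewrite -mleadc_eq0 mleadZ // mleadXm mcoeffZ mcoeffX eqxx mulr1.
have mh : mlead fj = mlead h by rewrite mleadM ?n0 // mleadZ // mleadXm submK.
have Ifh : I (fj - h).
  by rewrite -scaleN1r -mul_mpolyC; apply: ID => //; apply: (IM _ _); apply: (IM _ _).
have /negP := minj _ Ifh nfh; apply; apply: mlead_cancel => //.
rewrite /h mleadM ?n0 // mleadcM mleadZ // mleadXm mcoeffZ mcoeffX eqxx mulr1 divfK //.
by rewrite mleadc_eq0 n0.
Qed.
End Hilbert.

(** * Affine equations over a subfield *)

(** The b' are the images of the b under an E-linear retraction of N onto E. Each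
    b_t is either an affine combination of the others, which prescribes its image,
    or affinely independent of them, and then any image is allowed. *)
Lemma affine_retraction (E N : fieldType) (i : {rmorphism E -> N}) m (b : 'I_m -> N) :
  exists b' : 'I_m -> E, forall c0 (c : 'I_m -> E),
    i c0 + \sum_t i (c t) * b t = 0 -> c0 + \sum_t c t * b' t = 0.
Proof.
elim: m b => [|m IH] b.
  exists (fun=> 0) => c0 c; rewrite !big_ord0 !addr0 => /eqP.
  by rewrite fmorph_eq0 => /eqP.
have [b' b'P] := IH (fun t => b (lift ord_max t)).
pose ext v (t : 'I_m.+1) := if unlift ord_max t is Some t' then b' t' else v.
have extE (c : 'I_m.+1 -> E) v : \sum_t c t * ext v t =
    c ord_max * v + \sum_t c (lift ord_max t) * b' t.
  rewrite (bigD1_ord ord_max) //= /ext unlift_none; congr (_ + _).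
  by apply: eq_bigr => t _; rewrite liftK.
have [[u0 [u bE]]|nspan] := EM (exists u0 (u : 'I_m -> E),
    b ord_max = i u0 + \sum_t i (u t) * b (lift ord_max t)).
  exists (ext (u0 + \sum_t u t * b' t)) => c0 c; rewrite extE.
  rewrite (bigD1_ord ord_max) //= bE => H.
  have := b'P (c0 + c ord_max * u0) (fun t => c (lift ord_max t) + c ord_max * u t).
  have -> : \sum_t i (c (lift ord_max t) + c ord_max * u t) * b (lift ord_max t) =
      \sum_t i (c (lift ord_max t)) * b (lift ord_max t) +
      i (c ord_max) * \sum_t i (u t) * b (lift ord_max t).
    rewrite mulr_sumr -big_split; apply: eq_bigr => t _ /=.
    by rewrite rmorphD rmorphM; ring.
  have -> : \sum_t (c (lift ord_max t) + c ord_max * u t) * b' t =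
      \sum_t c (lift ord_max t) * b' t + c ord_max * \sum_t u t * b' t.
    by rewrite mulr_sumr -big_split; apply: eq_bigr => t _ /=; ring.
  move=> HE; rewrite -[RHS]HE; first by ring.
  by rewrite -[RHS]H rmorphD rmorphM; ring.
exists (ext 0) => c0 c; rewrite extE mulr0 add0r (bigD1_ord ord_max) //= => H.
have [cm|cm] := eqVneq (c ord_max) 0.
  by apply: (b'P c0 (fun t => c (lift ord_max t))); rewrite cm rmorph0 mul0r add0r in H.
case: nspan; exists (- c0 / c ord_max), (fun t => - c (lift ord_max t) / c ord_max).
have icm : i (c ord_max) != 0 by rewrite fmorph_eq0.
have -> : \sum_t i (- c (lift ord_max t) / c ord_max) * b (lift ord_max t) =
    - (\sum_t i (c (lift ord_max t)) * b (lift ord_max t)) / i (c ord_max).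
  rewrite -sumrN mulr_suml; apply: eq_bigr => t _.
  by rewrite fmorph_div rmorphN; field.
rewrite fmorph_div rmorphN.
apply: (mulfI icm); apply/eqP; rewrite -subr_eq0 -[X in _ == X]H; apply/eqP.
by field.
Qed.

(** * Extending morphisms to an algebraically closed field *)

Lemma factor_surjective (A R S : comNzRingType) (r : {rmorphism A -> R})
    (psi : {rmorphism A -> S}) :
  (forall x, exists f, x = r f) -> (forall f, r f = 0 -> psi f = 0) ->
  exists phi : {rmorphism R -> S}, forall f, phi (r f) = psi f.
Proof.
move=> /choice[g gP] r0.
have rE f f' : r f = r f' -> psi f = psi f'.
  move=> E; apply/eqP; rewrite -subr_eq0 -rmorphB r0 //.
  by rewrite rmorphB E subrr.
pose phi x := psi (g x).
have phiB : zmod_morphism phi.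
  by move=> x y; rewrite /phi -rmorphB; apply: rE; rewrite rmorphB -!gP.
have phiM : monoid_morphism phi.
  split=> [|x y]; rewrite /phi.
    by rewrite -(rmorph1 psi); apply: rE; rewrite -gP rmorph1.
  by rewrite -rmorphM; apply: rE; rewrite rmorphM -!gP.
pose pZ := GRing.isZmodMorphism.Build _ _ phi phiB.
pose pM := GRing.isMonoidMorphism.Build _ _ phi phiM.
exists (HB.pack phi pZ pM : {rmorphism R -> S}) => f /=.
by apply: rE; rewrite -gP.
Qed.

Section Nullstellensatz.
Variables (K : fieldType) (Omega : closedFieldType) (iota : {rmorphism K -> Omega}).
Variables (N : fieldType).

(** Any nonzero element of R survives in some point of R over K with values in
    Omega. *)
Definition extendable (R : comNzRingType) (kappa : K -> R) : Prop :=
  forall g : R, g != 0 -> exists phi : {rmorphism R -> Omega},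
    (forall a, phi (kappa a) = iota a) /\ phi g != 0.

Lemma min_size (R : nzRingType) (P : {poly R} -> Prop) :
  (exists f, P f) -> exists f, P f /\ forall g, P g -> (size f <= size g)%N.
Proof.
move=> [f Pf]; pose Q k := `[< exists2 f, P f & size f = k >].
have Qex : exists k, Q k by exists (size f); apply/asboolP; exists f.
case: (ex_minnP Qex) => _ /asboolP[g Pg <-] H; exists g; split=> // g' Pg'.
by apply: H; apply/asboolP; exists g'.
Qed.

Section Step.
Variables (R : comNzRingType) (i : {rmorphism R -> N}) (x : N).
Hypothesis i_inj : injective i.

Let r : {rmorphism {poly R} -> N} := horner_morph (mul_comm_rmorph i x).

Let i_neq0 a : (i a == 0) = (a == 0).
Proof. by rewrite -(rmorph0 i) (inj_eq i_inj). Qed.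
Let rZ a (f : {poly R}) : r (a *: f) = i a * r f.
Proof. by rewrite /r /= /horner_morph map_polyZ hornerZ. Qed.
Let rC a : r a%:P = i a.
Proof. by rewrite /r /= /horner_morph map_polyC hornerC. Qed.
Let size_i f : size (map_poly i f) = size f.
Proof. by apply: size_map_inj_poly => //; rewrite rmorph0. Qed.

Lemma pseudo_div (f g : {poly R}) : g != 0 ->
  exists s Q f', let c := lead_coef g ^+ s in
    [/\ c != 0, c *: f = Q * g + f' & (size f' < size g)%N].
Proof.
move=> g0; exists (Pdiv.Ring.rscalp f g), (Pdiv.Ring.rdivp f g),
  (Pdiv.Ring.rmodp f g).
split; last by rewrite Pdiv.Ring.ltn_rmodp.
  by rewrite -i_neq0 rmorphXn expf_neq0 // i_neq0 lead_coef_eq0.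
exact: Pdiv.ComRing.rdivp_eq.
Qed.

(** Let P be a relation of least degree of x over R. Among the combinations of G
    and P which do not vanish at x, one of least degree is constant: otherwise
    pseudo-division of P by it leaves a smaller one or a smaller relation. *)
Lemma alg_bezout (P G : {poly R}) :
  P != 0 -> r P = 0 -> (forall f, f != 0 -> r f = 0 -> (size P <= size f)%N) ->
  r G != 0 -> exists h U V, h != 0 /\ h%:P = U * G + V * P.
Proof.
move=> P0 rP Pmin rG.
pose J H := r H != 0 /\ exists U V, H = U * G + V * P.
have [|H [[rH [U [V HE]]] Hmin]] := @min_size R J.
  by exists G; split=> //; exists 1, 0; rewrite mul1r mul0r addr0.
have H0 : H != 0 by apply: contraNneq rH => ->; rewrite rmorph0.
have HP : (size H < size P)%N.
  have [s [Q [f []]]] := pseudo_div H P0; set c := _ ^+ s => c0 E sf.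
  apply: leq_ltn_trans sf; apply: Hmin.
  have fE : f = c *: H - Q * P by rewrite E addrC addKr.
  split; first by rewrite fE rmorphB rmorphM rP mulr0 subr0 rZ mulf_neq0 ?i_neq0.
  exists (c *: U), (c *: V - Q); rewrite fE HE scalerDr !scalerAl mulrBl; ring.
have [s [Q [f []]]] := pseudo_div P H0; set c := _ ^+ s => c0 E sf.
have fE : f = c *: P - Q * H by rewrite E addrC addKr.
have rf : r f = 0.
  apply: contrapT => /eqP rf; have := Hmin f; rewrite leqNgt sf => /(_ _)/notF; apply.
  split=> //; exists (- Q * U), (c%:P - Q * V); rewrite fE HE -mul_polyC; ring.
have f0 : f = 0.
  apply: contrapT => /eqP f0; have := Pmin f f0 rf.
  by rewrite leqNgt (ltn_trans sf).
rewrite f0 addr0 in E.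
have rQ : r Q = 0.
  apply/eqP; have := congr1 r E; rewrite rmorphM rZ rP mulr0 => /esym/eqP.
  by rewrite mulf_eq0 (negbTE rH) orbF.
have cP : c *: P != 0.
  by rewrite -size_poly_gt0 -size_i map_polyZ size_scale ?i_neq0 // size_i size_poly_gt0.
have Q0 : Q != 0 by apply: contraNneq cP => Q0; rewrite E Q0 mul0r.
have : (size H <= 1)%N.
  have := congr1 (fun f => size (map_poly i f)) E; rewrite rmorphM map_polyZ /=.
  rewrite size_scale ?i_neq0 // size_mul; last 2 first.
  - by rewrite -size_poly_gt0 size_i size_poly_gt0.
  - by rewrite -size_poly_gt0 size_i size_poly_gt0.
  rewrite !size_i => sE; have := Pmin _ Q0 rQ; rewrite sE.
  have : (0 < size H)%N by rewrite size_poly_gt0.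
  case: (size H) => // k _.
  by rewrite addnS /= -[X in (_ <= X)%N]addn0 leq_add2l leqn0 => /eqP ->.
move=> /size1_polyC HC; exists H`_0, U, V; rewrite -HC; split=> //.
by apply: contraNneq H0 => E0; rewrite HC E0.
Qed.

(** If x is transcendental over R, avoid the roots of the image of G. If it is
    algebraic with least relation P, send x to a root of the image of P; the
    Bezout relation h = U G + V P keeps the value of G away from zero once h
    and the leading coefficient of P are. *)
Lemma extendable_adjoin (kappa : {rmorphism K -> R}) :
  extendable kappa ->
  exists (R1 : comNzRingType) (i1 : {rmorphism R1 -> N}) (j : {rmorphism R -> R1}),
    [/\ injective i1, forall a, i1 (j a) = i a, extendable (j \o kappa)
      & exists y, i1 y = x].
Proof.
move=> ext.
have [R1 [i1 [r' [i1_inj r'E surj]]]] := exists_image_ring r.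
exists R1, i1, (r' \o polyC); split=> //.
- by move=> a; rewrite /= r'E rC.
- move=> g1; have [G ->] := surj g1 => G0.
  have rG : r G != 0 by rewrite -r'E -(rmorph0 i1) (inj_eq i1_inj).
  suff [phi [om [phiK phir phiG]]] : exists (phi : {rmorphism R -> Omega}) om,
      [/\ forall a, phi (kappa a) = iota a,
          forall f, r f = 0 -> (map_poly phi f).[om] = 0 & (map_poly phi G).[om] != 0].
    have com : commr_rmorph phi om by move=> a; apply: mulrC.
    have [|phi1 phi1E] := @factor_surjective _ _ _ r' (horner_morph com) surj.
      by move=> f /(congr1 i1); rewrite r'E rmorph0; apply: phir.
    exists phi1; rewrite phi1E; split=> // a.
    by rewrite /= phi1E /= /horner_morph map_polyC hornerC; apply: phiK.
  have [[P0 [P00 rP0]]|tr] := EM (exists P, P != 0 /\ r P = 0); last first.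
    have G0' : G != 0 by apply: contraNneq rG => ->; rewrite rmorph0.
    have [|phi [phiK phiG]] := ext (lead_coef G); first by rewrite lead_coef_eq0.
    have : map_poly phi G != 0.
      by rewrite -lead_coef_eq0 lead_coef_map_eq.
    move=> /closed_nonrootP[om omG]; exists phi, om; split=> // f rf.
    have -> : f = 0 by apply: contrapT => /eqP f0; apply: tr; exists f.
    by rewrite rmorph0 horner0.
  have [|P [[P_0 rP] Pmin]] := @min_size R (fun P => P != 0 /\ r P = 0).
    by exists P0.
  have {}Pmin f : f != 0 -> r f = 0 -> (size P <= size f)%N by move=> ? ?; apply: Pmin.
  have [h [U [V [h0 hE]]]] := alg_bezout P_0 rP Pmin rG.
  have [|phi [phiK phih]] := ext (h * lead_coef P).
    by rewrite -i_neq0 rmorphM mulf_neq0 // i_neq0 ?lead_coef_eq0.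
  rewrite rmorphM mulf_eq0 negb_or in phih; case/andP: phih => phih phiP.
  have sP : size (map_poly phi P) = size P by rewrite size_poly_eq.
  have [|om omP] := closed_rootP (map_poly phi P) _.
    rewrite sP; apply: contra P_0 => /size_poly1P[c c0 PE].
    by move/eqP: rP; rewrite PE rC i_neq0 (negbTE c0).
  exists phi, om; split=> //.
    move=> f rf; have [s [Q [f' [c0 E sf]]]] := pseudo_div f P_0.
    have f'0 : f' = 0.
      apply: contrapT => /eqP f'0; have := Pmin f' f'0; rewrite leqNgt sf => /(_ _)/notF.
      apply; have -> : f' = lead_coef P ^+ s *: f - Q * P by rewrite E addrC addKr.
      by rewrite rmorphB rmorphM rZ rf rP !mulr0 subrr.
    have := congr1 (fun f => (map_poly phi f).[om]) E.
    rewrite f'0 addr0 rmorphM map_polyZ hornerZ hornerM (rootP omP) mulr0 rmorphXn.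
    by move/eqP; rewrite mulf_eq0 expf_eq0 (negbTE phiP) andbF => /eqP.
  apply: contraNneq phih => GE.
  have := congr1 (fun f => (map_poly phi f).[om]) hE.
  rewrite rmorphD !rmorphM /= map_polyC hornerC hornerD !hornerM GE (rootP omP) => ->.
  by rewrite !mulr0 addr0.
- by exists (r' 'X); rewrite r'E /r /= /horner_morph map_polyX hornerX.
Qed.
End Step.

End Nullstellensatz.

(** * Evaluation of polynomials and of their prolongations *)

Lemma rmorph_mmap m (K R S : comNzRingType) (phi : K -> R) (z : 'I_m -> R)
    (psi : {rmorphism R -> S}) f :
  psi (mmap phi z f) = mmap (psi \o phi) (psi \o z) f.
Proof.
rewrite /mmap rmorph_sum; apply: eq_bigr => a _; rewrite rmorphM; congr (_ * _).
by rewrite /mmap1 rmorph_prod; apply: eq_bigr => j _; rewrite rmorphXn.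
Qed.

Lemma eq_mmap m (K S : comNzRingType) (phi phi' : K -> S) (z z' : 'I_m -> S) :
  phi =1 phi' -> z =1 z' -> mmap phi z =1 mmap phi' z'.
Proof.
move=> phiE zE f; rewrite /mmap; apply: eq_bigr => a _; rewrite phiE; congr (_ * _).
by apply: eq_bigr => j _; rewrite zE.
Qed.

Lemma rmorph_mpolyE m (K S : comNzRingType) (psi : {rmorphism {mpoly K[m]} -> S}) f :
  psi f = mmap (psi \o @mpolyC m K) (fun j => psi 'X_j) f.
Proof.
rewrite {1}[f]mpolyE rmorph_sum; apply: eq_bigr => a _.
rewrite -mul_mpolyC rmorphM mpolyXE_id rmorph_prod; congr (_ * _).
by apply: eq_bigr => j _; rewrite rmorphXn.
Qed.

Section Bundle.
Variables (m : nat) (K : fieldType) (S : comNzRingType) (phi : {rmorphism K -> S}).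
Variable w : 'I_(m + m) -> S.

Lemma mmap_in_X f : mmap phi w (in_X f) = mmap phi (fun j => w (lshift m j)) f.
Proof.
rewrite /in_X /comp_mpoly.
rewrite (@rmorph_mmap _ _ _ _ _ _ (mmap phi w : {rmorphism {mpoly K[m + m]} -> S})).
apply: eq_mmap => [c|j] /=; first exact: mmapC.
by rewrite tnth_mktuple mmapX mmap1U.
Qed.

Lemma mmap_prolong p n (d : K -> K) f :
  Fr_derivation p n d ->
  mmap phi w (prolong p n d f) =
  mprolong p n phi (phi \o d) (fun j => w (lshift m j)) (fun j => w (rshift m j)) f.
Proof.
move=> [dD _].
have dB : zmod_morphism d.
  have d0 : d 0 = 0.
    by have := dD 0 0; rewrite addr0 => /(canLR (addrK _)); rewrite subrr.
  by move=> x y; apply: (canRL (addrK _)); rewrite -dD subrK.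
pose d' : {additive K -> K} := HB.pack d (GRing.isZmodMorphism.Build K K d dB).
pose ev : {rmorphism {mpoly K[m + m]} -> S} := mmap phi w.
rewrite /prolong /mprolong -/(ev _) rmorphD; congr (_ + _); last first.
  rewrite rmorph_sum; apply: eq_bigr => j _.
  rewrite rmorphM rmorphXn /ev /= mmap_in_X; congr (_ * _).
  by rewrite mmapX mmap1U.
rewrite /comp_mpoly rmorph_mmap /=.
have -> : mmap (ev \o @mpolyC _ K) (ev \o tnth [tuple 'X_(lshift m i) ^+ (p ^ n) | i < m])
    (map_mpoly d f) = mmap phi (fun j => w (lshift m j) ^+ (p ^ n)) (map_mpoly d f).
  apply: eq_mmap => [c|j] /=; first exact: mmapC.
  by rewrite tnth_mktuple rmorphXn /ev /= mmapX mmap1U.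
pose k := maxn (msize f) (msize (map_mpoly d f)).
rewrite (@mmapE _ _ _ _ phi _ k) ?leq_maxr //.
rewrite (@mmapE _ _ _ _ (phi \o d' : {additive K -> S}) f k) ?leq_maxl //.
by apply: eq_bigr => a _; rewrite (mcoeff_map_mpoly d').
Qed.
End Bundle.

(** * Function fields *)

Lemma factor_fractions (A : comNzRingType) (k N : fieldType) (r : {rmorphism A -> k})
    (psi : {rmorphism A -> N}) :
  (forall x, exists f g, r g != 0 /\ x = r f / r g) ->
  (forall f, r f = 0 <-> psi f = 0) ->
  exists G : {rmorphism k -> N}, forall f, G (r f) = psi f.
Proof.
move=> surj ker.
have nz f : r f != 0 -> psi f != 0 by apply: contraNneq => /ker ->.
have rE f g : r f = r g -> psi f = psi g.
  by move=> E; apply/eqP; rewrite -subr_eq0 -rmorphB; apply/eqP/ker; rewrite rmorphB E subrr.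
have /choice[G GP] x : exists y, forall f g, r g != 0 -> x * r g = r f ->
    y * psi g = psi f.
  have [f [g [g0 ->]]] := surj x; exists (psi f / psi g) => f' g' g'0 E.
  rewrite mulrAC; apply: (canLR (mulfK (nz _ g0))).
  rewrite -!rmorphM; apply: rE; rewrite !rmorphM -E; field.
  exact: g0.
have canc g (a b : N) : r g != 0 -> a * psi g = b * psi g -> a = b.
  by move=> g0; apply: mulIf; apply: nz.
have Gr f : G (r f) = psi f.
  have := GP (r f) f 1; rewrite !rmorph1 !mulr1; apply=> //; exact: oner_neq0.
have GB : zmod_morphism G.
  move=> x y; have [f [g [g0 xE]]] := surj x; have [f' [g' [g'0 yE]]] := surj y.
  have Ex : x * r g = r f by rewrite xE divfK.
  have Ey : y * r g' = r f' by rewrite yE divfK.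
  have gg'0 : r (g * g') != 0 by rewrite rmorphM mulf_neq0.
  apply: (canc _ _ _ gg'0); rewrite (GP _ (f * g' - f' * g)) //; last first.
    by rewrite rmorphB !rmorphM -Ex -Ey; ring.
  by rewrite rmorphB !rmorphM -(GP _ _ _ g0 Ex) -(GP _ _ _ g'0 Ey); ring.
have GM : monoid_morphism G.
  split=> [|x y]; first by rewrite -(rmorph1 r) Gr rmorph1.
  have [f [g [g0 xE]]] := surj x; have [f' [g' [g'0 yE]]] := surj y.
  have Ex : x * r g = r f by rewrite xE divfK.
  have Ey : y * r g' = r f' by rewrite yE divfK.
  have gg'0 : r (g * g') != 0 by rewrite rmorphM mulf_neq0.
  apply: (canc _ _ _ gg'0); rewrite (GP _ (f * f')) //; last first.
    by rewrite !rmorphM -Ex -Ey; ring.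
  by rewrite !rmorphM -(GP _ _ _ g0 Ex) -(GP _ _ _ g'0 Ey); ring.
pose gZ := GRing.isZmodMorphism.Build _ _ G GB.
pose gM := GRing.isMonoidMorphism.Build _ _ G GM.
by exists (HB.pack G gZ gM : {rmorphism k -> N}).
Qed.

Lemma fraction_numden (R : idomainType) (x : {fraction R}) :
  exists a b : R, FracField.tofrac b != 0 /\
    x = FracField.tofrac a / FracField.tofrac b.
Proof.
elim/quotW: x => y; exists (\n_y), (\d_y).
have d0 : FracField.tofrac (\d_y) != 0 by rewrite tofrac_eq0 denom_ratioP.
split=> //; apply: (mulIf d0); rewrite divfK //.
rewrite -[LHS]/(FracField.mul _ _) !piE; apply/eqP; rewrite piE /=.
rewrite FracField.equivfE /FracField.mulf !numden_Ratio ?mulr1 ?denom_ratioP ?oner_neq0 //.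
by rewrite mulrC.
Qed.

Section Varieties.
Variables (K : fieldType) (Omega : closedFieldType) (iota : {rmorphism K -> Omega}).

Lemma regular_fun_rmorphism m (V : irr_variety iota m) :
  exists r : {rmorphism {mpoly K[m]} -> function_field V},
    [/\ forall f, r f = regular_fun V f, forall f, r f = 0 <-> vanishing iota V f
      & forall x, exists f g, r g != 0 /\ x = r f / r g].
Proof.
pose pi : {rmorphism {mpoly K[m]} -> coord_ring V} :=
  \pi_{ideal_quot (vanishing_ideal V)}.
pose r : {rmorphism {mpoly K[m]} -> function_field V} :=
  (@FracField.tofrac (coord_ring V) \o pi).
have rE f : r f = regular_fun V f by [].
exists r; split=> //.
- move=> f; rewrite rE /regular_fun; split.
    move/eqP; rewrite tofrac_eq0 => /eqP pf0.
    have : f - 0 \in vanishing_ideal V.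
      by rewrite Quotient.idealrBE; apply/eqP; rewrite -/(pi f) pf0 -/(pi 0) rmorph0.
    by rewrite subr0 => /asboolP.
  move=> Vf; apply/eqP; rewrite tofrac_eq0 -/(pi f) -(rmorph0 pi) /pi /=.
  by rewrite -Quotient.idealrBE subr0; apply/asboolP.
- move=> x; have [a [b [b0 ->]]] := fraction_numden x.
  have pi_surj c : exists f, pi f = c by exists (repr c); apply: reprK.
  have [[f <-] [g gE]] := (pi_surj a, pi_surj b).
  by exists f, g; rewrite /r /= gE.
Qed.

End Varieties.

(** * The locus of a tuple *)

Section Locus.
Variables (K : fieldType) (Omega : closedFieldType) (iota : {rmorphism K -> Omega}).
Variables (N : fieldType) (h : {rmorphism K -> N}).

(** The ring R is K[xs]. *)
Lemma extendable_adjoins (xs : seq N) :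
  exists (R : comNzRingType) (i : {rmorphism R -> N}) (kappa : {rmorphism K -> R}),
    [/\ injective i, forall a, i (kappa a) = h a, extendable iota kappa
      & forall x, x \in xs -> exists y, i y = x].
Proof.
elim: xs => [|x xs [R [i [kappa [i_inj iE ext xsP]]]]].
  exists K, h, idfun; split=> //; first exact: fmorph_inj.
  by move=> g g0; exists iota; rewrite fmorph_eq0.
have [R1 [i1 [j [i1_inj jE ext1 [y yx]]]]] := extendable_adjoin x i_inj ext.
exists R1, i1, (j \o kappa); split=> //; first by move=> a; rewrite /= jE.
move=> z; rewrite inE => /orP[/eqP ->|/xsP[u <-]]; first by exists y.
by exists (j u).
Qed.

Lemma nullstellensatz m (a : 'I_m -> N) (g : {mpoly K[m]}) :
  mmap h a g != 0 ->
  exists w : 'rV[Omega]_m,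
    (forall f, mmap h a f = 0 -> peval iota f w = 0) /\ peval iota g w != 0.
Proof.
move=> ga.
have [R [i [kappa [i_inj iE ext xsP]]]] := extendable_adjoins (codom a).
have /choice[y yP] t : exists y, i y = a t by apply: xsP; apply: codom_f.
have ev f : i (mmap kappa y f) = mmap h a f.
  by rewrite rmorph_mmap; apply: eq_mmap => ?; rewrite /= ?iE ?yP.
have i0 u : (i u == 0) = (u == 0) by rewrite -(rmorph0 i) (inj_eq i_inj).
have [|phi [phiK phig]] := ext (mmap kappa y g); first by rewrite -i0 ev.
have pe f : peval iota f (\row_t phi (y t)) = phi (mmap kappa y f).
  by rewrite rmorph_mmap; apply: eq_mmap => t /=; rewrite ?phiK ?mxE.
exists (\row_t phi (y t)); rewrite pe; split=> // f fa; rewrite pe.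
have -> : mmap kappa y f = 0 by apply/eqP; rewrite -i0 ev fa.
exact: rmorph0.
Qed.

Variables (m : nat) (a : 'I_m -> N).

Definition locus_points : 'rV[Omega]_m -> Prop :=
  zero_locus iota (fun f => mmap h a f = 0).

(** Kernels of evaluations are prime, so no radical appears. *)
Lemma vanishing_locus f : vanishing iota locus_points f <-> mmap h a f = 0.
Proof.
split=> [Vf|fa w]; last exact.
apply/eqP; apply: contrapT => /negP /nullstellensatz[w [aw /eqP]].
by case; apply: Vf.
Qed.

Lemma locus_variety : is_variety iota locus_points.
Proof.
exists (fun f => mmap h a f = 0); split=> //; split=> [|f g fa ga|f g ga].
- exact: mmap0.
- by rewrite mmapD fa ga addr0.
- by rewrite rmorphM /= ga mulr0.
Qed.

Lemma locus_irreducible : irreducible iota locus_points.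
Proof.
split.
  have [|w [aw _]] := @nullstellensatz m a 1; last by exists w.
  by rewrite rmorph1 oner_neq0.
move=> V1 V2 [I1 [_ V1E]] [I2 [_ V2E]] VE.
have sub I (V' : 'rV[Omega]_m -> Prop) : (forall w, V' w <-> zero_locus iota I w) ->
    (forall w, V' w -> locus_points w) ->
    (forall f, I f -> mmap h a f = 0) -> forall w, locus_points w <-> V' w.
  by move=> V'E V'V Ia w; split=> [aw|]; [apply/V'E => f /Ia; apply: aw|apply: V'V].
have [I1a|/existsNP[f1 /not_implyP[If1 f1a]]] := EM (forall f, I1 f -> mmap h a f = 0).
  by left; apply: sub V1E _ I1a => w V1w; apply/VE; left.
right; apply: (sub I2 V2 V2E) => [w V2w|f2 If2]; first by apply/VE; right.
apply/eqP; have /eqP : mmap h a (f1 * f2) = 0.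
  apply/vanishing_locus => w /VE[/V1E/(_ _ If1)|/V2E/(_ _ If2)] E.
    by rewrite pevalM E mul0r.
  by rewrite pevalM E mulr0.
by rewrite rmorphM mulf_eq0 => /orP[/eqP|].
Qed.

Definition locus : irr_variety iota m :=
  IrrVariety locus_variety locus_irreducible.

(** The function field of the locus of a is K(a). *)
Lemma function_field_locus :
  exists G : {rmorphism function_field locus -> N},
    (forall f, G (regular_fun locus f) = mmap h a f) /\
    forall x, exists f g, mmap h a g != 0 /\ G x = mmap h a f / mmap h a g.
Proof.
have [r [rE rker rsurj]] := regular_fun_rmorphism locus.
have [|G GE] := @factor_fractions _ _ _ r (mmap h a) rsurj.
  by move=> f; rewrite rker; apply: vanishing_locus.
exists G; split=> [f|x]; first by rewrite -rE.
have [f [g [g0 ->]]] := rsurj x; exists f, g.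
rewrite fmorph_div !GE; split=> //.
have : G (r g) != 0 by rewrite fmorph_eq0.
by rewrite GE.
Qed.

End Locus.

(** A family that is linearly independent over k = L has at most one element. *)
Lemma surjective_separable p (k L : fieldType) (phi : {rmorphism k -> L}) :
  (forall y, exists x, phi x = y) -> separable_ext p phi.
Proof.
move=> /choice[g gP] M j r x xfree b _ bx.
have x0 t : x t != 0.
  apply/eqP => xt; pose c u : k := (u == t)%:R.
  have : \sum_u phi (c u) * x u = 0.
    rewrite (bigD1 t) //= xt mulr0 add0r big1 // => u /negbTE ut.
    by rewrite /c ut rmorph0 mul0r.
  by move=> /xfree/(_ t)/eqP; rewrite /c eqxx oner_eq0.
have all_eq (t u : 'I_r) : t = u.
  apply/eqP; apply: contrapT => /negP tu.
  pose c v : k := if v == t then g (x u) else if v == u then - g (x t) else 0.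
  have : \sum_v phi (c v) * x v = 0.
    rewrite (bigD1 t) //= (bigD1 u) 1?eq_sym //= big1; last first.
      by move=> v /andP[/negbTE vt /negbTE vu]; rewrite /c vt vu rmorph0 mul0r.
    by rewrite /c eqxx [u == t]eq_sym (negbTE tu) eqxx rmorphN !gP; ring.
  move=> /xfree/(_ t)/(congr1 phi); rewrite /c eqxx gP rmorph0 => /eqP.
  by rewrite (negbTE (x0 u)).
move=> t; move: bx; rewrite (bigD1 t) //= big1 ?addr0; last first.
  by move=> u; rewrite (all_eq u t) eqxx.
by move/eqP; rewrite mulf_eq0 fmorph_eq0 (negbTE (x0 t)) orbF => /eqP.
Qed.

(** * From the geometric condition to local retractions *)

Definition geometric_axiom (p n : nat) (K : fieldType) (d : K -> K)
    (Omega : closedFieldType) (iota : {rmorphism K -> Omega}) : Prop :=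
  forall (m : nat) (V : irr_variety iota m) (W : irr_variety iota (m + m)),
    (forall w, W w -> twisted_bundle iota p n d V w) ->
    separable_proj p V W ->
    exists a : 'rV[K]_m,
      V (map_mx iota a) /\ W (row_mx (map_mx iota a) (map_mx (iota \o d) a)).

Lemma peval_in_X (K : fieldType) (Omega : closedFieldType)
    (iota : {rmorphism K -> Omega}) m (f : {mpoly K[m]}) (w : 'rV[Omega]_(m + m)) :
  peval iota (in_X f) w = peval iota f (lsubmx w).
Proof.
by rewrite /peval mmap_in_X; apply: eq_mmap => // j; rewrite mxE.
Qed.

Section Specialization.
Variables (p n : nat) (K : fieldType) (d : K -> K).
Variables (Omega : closedFieldType) (iota : {rmorphism K -> Omega}).
Hypothesis d_der : Fr_derivation p n d.
Hypothesis geom : geometric_axiom p n d iota.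
Variables (N : fieldType) (D : N -> N) (h : {rmorphism K -> N}).
Hypotheses (charN : p \in [pchar N]) (D_der : Fr_derivation p n D).
Hypothesis hd : forall k, h (d k) = D (h k).
Let q := (p ^ n)%N.

(** Both sides are Frobenius derivations that agree on constants and variables. *)
Lemma derivation_mmap m (a : 'I_m -> N) f :
  D (mmap h a f) = mprolong p n h (h \o d) a (fun t => D (a t)) f.
Proof.
have [DD DM] := D_der.
apply: (@frob_derivation_mpoly_unique p n K N h (h \o d) charN
  (frob_derivation_comp h d_der) _ a _
  (fun f => D (mmap h a f))).
- by split=> f1 f2; rewrite ?raddfD ?rmorphM /= ?DD ?DM.
- by move=> c; rewrite mmapC /= hd.
- by move=> t; rewrite mmapX mmap1U.
Qed.

(** The pair (a, D a) is replaced by (a, b) with b in K(a), so that the loci of a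
    and of (a, b) have the same function field. No relation of the form
    D(a_t) = a_u is lost, since a linear retraction onto K(a) fixes a_u. *)
Lemma specialization m (a : 'I_m -> N) :
  exists x : 'I_m -> K,
    (forall f, mmap h a f = 0 -> mmap idfun x f = 0) /\
    forall t u, D (a t) = a u -> d (x t) = x u.
Proof.
pose r : {rmorphism {mpoly K[m]} -> N} := mmap h a.
have [E [i [r' [r'E surj]]]] := exists_frac_field r.
have [b bP] := affine_retraction i (fun t => D (a t)).
pose w (j : 'I_(m + m)) : N :=
  match split j with inl t => a t | inr t => i (b t) end.
have wl t : w (lshift m t) = a t by rewrite /w (unsplitK (inl t)).
have wr t : w (rshift m t) = i (b t) by rewrite /w (unsplitK (inr t)).
pose V := locus iota h a; pose W := locus iota h w.
have inX f : mmap h w (in_X f) = mmap h a f.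
  by rewrite mmap_in_X; apply: eq_mmap.
have WV : forall z, W z -> twisted_bundle iota p n d V z.
  move=> z Wz g Sg; apply: (Sg (fun f => peval iota f z = 0)) =>
    [|_ [f /vanishing_locus fa [->|->]]].
  - split; [exact: peval0|by move=> ? ? e1 e2; rewrite pevalD e1 e2 addr0|].
    by move=> ? ? e; rewrite pevalM e mulr0.
  - by apply: Wz; rewrite inX.
  apply: Wz; rewrite (mmap_prolong _ _ _ d_der).
  have := derivation_mmap a f; rewrite fa.
  have -> : D 0 = 0 by apply: (@frob0 q N N (idfun : {rmorphism N -> N}) D D_der).
  pose c t := r' f^`M(t) ^+ q.
  have [c0 c0E] : exists c0, i c0 = mmap (h \o d) (fun t => a t ^+ q) f.
    exists (mmap (fun k => r' (d k)%:MP) (fun t => r' 'X_t ^+ q) f).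
    rewrite rmorph_mmap; apply: eq_mmap => [k|t] /=.
      by rewrite r'E /r /= mmapC.
    by rewrite rmorphXn r'E /r /= mmapX mmap1U.
  have cE t : i (c t) = mmap h a f^`M(t) ^+ q by rewrite rmorphXn r'E.
  rewrite /mprolong -c0E => /esym.
  under eq_bigr do rewrite -cE.
  move=> /bP/(congr1 i); rewrite rmorphD rmorph0 rmorph_sum => E0.
  rewrite -[RHS]E0 c0E; congr (_ + _).
    by apply: eq_mmap => // t; rewrite wl.
  apply: eq_bigr => t _; rewrite wr rmorphM cE; congr (_ ^+ _ * _).
  by apply: eq_mmap => // u; rewrite wl.
have sepVW : separable_proj p V W.
  split; [split|].
  - by move=> z Wz f fa; rewrite -peval_in_X; apply: Wz; rewrite inX.
  - move=> Z [I [_ ZE]] WZ v Vv; apply/ZE => f If; apply: Vv; rewrite -inX.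
    apply/(vanishing_locus iota) => z /WZ/ZE/(_ _ If); by rewrite peval_in_X.
  have [GV [GVr GVE]] := function_field_locus iota h a.
  have [GW [GWr GWE]] := function_field_locus iota h w.
  have sub1 x : exists y, GW y = GV x.
    have [f [g [g0 ->]]] := GVE x; exists (regular_fun W (in_X f) / regular_fun W (in_X g)).
    by rewrite fmorph_div !GWr !inX.
  have sub2 y : exists x, GV x = GW y.
    have /choice[z zP] j : exists x, GV x = w j.
      rewrite /w; case: (split j) => t.
        by exists (regular_fun V 'X_t); rewrite GVr mmapX mmap1U.
      have [f [g [g0 ->]]] := surj (b t); exists (regular_fun V f / regular_fun V g).
      by rewrite !fmorph_div !GVr !r'E.
    have gen f : exists x, GV x = mmap h w f.
      exists (mmap (fun k => regular_fun V k%:MP) z f); rewrite rmorph_mmap.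
      by apply: eq_mmap => [k|j] /=; rewrite ?zP // GVr mmapC.
    have [f [g [_ ->]]] := GWE y; have [[x <-] [x' <-]] := (gen f, gen g).
    by exists (x / x'); rewrite fmorph_div.
  have [phi phiE] := corestriction (fmorph_inj GW) sub1.
  exists phi; split=> [f|].
    by apply: (fmorph_inj GW); rewrite phiE GVr GWr inX.
  apply: surjective_separable => y; have [x xy] := sub2 y.
  by exists x; apply: (fmorph_inj GW); rewrite phiE.
have [x [Vx Wx]] := geom WV sepVW.
have evK k (f : {mpoly K[k]}) (z : 'I_k -> K) :
    mmap iota (iota \o z) f = iota (mmap idfun z f).
  by rewrite rmorph_mmap; apply: eq_mmap.
exists (fun t => x 0 t); split=> [f fa|t u Dtu].
  apply: (fmorph_inj iota); rewrite -evK rmorph0 -[RHS](Vx f fa).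
  by apply: eq_mmap => // t; rewrite mxE.
have bE : b t = r' 'X_u.
  have rX v : i (r' 'X_v) = a v by rewrite r'E /r /= mmapX mmap1U.
  have := bP (- r' 'X_u) (fun v => (v == t)%:R).
  rewrite (bigD1 t) //= big1 => [|v /negbTE ->]; last by rewrite rmorph0 mul0r.
  rewrite [X in _ -> _ + X = _](bigD1 t) //= [X in _ -> _ + (_ + X) = _]big1; last first.
    by move=> v /negbTE ->; rewrite mul0r.
  rewrite eqxx rmorph1 !mul1r !addr0 rmorphN rX Dtu addNr => /(_ erefl)/eqP.
  by rewrite addrC subr_eq0 => /eqP.
apply: (fmorph_inj iota).
have := Wx ('X_(rshift m t) - 'X_(lshift m u)).
rewrite raddfB /= !mmapX !mmap1U wl wr bE r'E /r /= mmapX mmap1U subrr => /(_ erefl).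
rewrite /peval raddfB /= !mmapX !mmap1U row_mxEl row_mxEr !mxE /= => /eqP.
by rewrite subr_eq0 => /eqP.
Qed.
End Specialization.

Lemma InP (T : eqType) (x : T) s : List.In x s <-> x \in s.
Proof.
elim: s => //= y s IH; rewrite inE IH [x == y]eq_sym.
by split=> [[->|->]|/orP[/eqP ->|->]]; rewrite ?eqxx ?orbT //; [left|right].
Qed.

(** Specialize the list l of all elements mentioned by a retraction on s. The
    inverses of the differences ensure that distinct elements stay distinct. *)
Lemma geometric_locally_retractable p n (K : fieldType) (d : K -> K)
    (Omega : closedFieldType) (iota : {rmorphism K -> Omega})
    (N : fieldType) (D : N -> N) (h : {rmorphism K -> N}) :
  Fr_derivation p n d -> geometric_axiom p n d iota ->
  p \in [pchar N] -> Fr_derivation p n D -> (forall k, h (d k) = D (h k)) ->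
  @locally_retractable (dstruct_of d) (dstruct_of D) h.
Proof.
move=> d_der geom charN D_der hd s.
pose l := [:: 0; 1] ++ s ++ map -%R s ++ map D s ++
  [seq x + y | x <- s, y <- s] ++ [seq x * y | x <- s, y <- s] ++
  [seq (x - y)^-1 | x <- s, y <- s].
pose a (t : 'I_(size l)) := l`_t.
have aP x : x \in l -> exists t, a t = x.
  move=> xl; have il : (index x l < size l)%N by rewrite index_mem.
  by exists (Ordinal il); rewrite /a /= nth_index.
have [x [xP xD]] := specialization d_der geom charN D_der hd a.
have xE t u : a t = a u -> x t = x u.
  move=> tu; apply/eqP; rewrite -subr_eq0.
  have := xP ('X_t - 'X_u); rewrite !raddfB /= !mmapX !mmap1U tu subrr => /(_ erefl) ->.
  exact: eqxx.
have /choice[c0 c0P] y : exists z, forall t, a t = y -> x t = z.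
  have [[t <-]|H] := EM (exists t, a t = y); first by exists (x t) => u /xE.
  by exists 0 => t ty; case: H; exists t.
have c0E t : c0 (a t) = x t by rewrite (c0P (a t)).
have memD y z : y \in s -> z \in s -> y + z \in l.
  by move=> ys zs; rewrite /l !mem_cat (allpairs_f _ ys zs) !orbT.
have memM y z : y \in s -> z \in s -> y * z \in l.
  by move=> ys zs; rewrite /l !mem_cat (allpairs_f _ ys zs) !orbT.
have memV y z : y \in s -> z \in s -> (y - z)^-1 \in l.
  move=> ys zs; rewrite /l !mem_cat.
  by rewrite (allpairs_f (fun y z => (y - z)^-1) ys zs) !orbT.
have mem1 y : y \in s -> y \in l by move=> ys; rewrite /l !mem_cat ys !orbT.
have memN y : y \in s -> - y \in l by move=> ys; rewrite /l !mem_cat (map_f _ ys) !orbT.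
have memDer y : y \in s -> D y \in l by move=> ys; rewrite /l !mem_cat (map_f _ ys) !orbT.
exists c0; split=> /=.
- have [|t0 t0E] := aP 0; first by rewrite /l inE eqxx.
  have [|t1 t1E] := aP 1; first by rewrite /l !inE eqxx orbT.
  rewrite -t0E -t1E !c0E; split.
    by have := xP 'X_t0; rewrite !mmapX !mmap1U => /(_ t0E).
  apply/eqP; rewrite -subr_eq0; apply/eqP.
  have := xP ('X_t1 - 1); rewrite !raddfB /= !mmapX !mmap1U !rmorph1 t1E subrr.
  by move=> /(_ erefl).
- move=> y /InP ys; have [[t tE] [u uE]] := (aP _ (mem1 _ ys), aP _ (memN _ ys)).
  have [v vE] := aP _ (memDer _ ys); rewrite -vE -uE -tE !c0E; split.
    apply/eqP; rewrite -addr_eq0; apply/eqP.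
    have := xP ('X_u + 'X_t); rewrite !raddfD /= !mmapX !mmap1U uE tE addNr.
    by move=> /(_ erefl).
  by rewrite (xD t v) // tE.
- move=> y z /InP ys /InP zs.
  have [[t tE] [u uE]] := (aP _ (mem1 _ ys), aP _ (mem1 _ zs)).
  have [[v vE] [w wE]] := (aP _ (memD _ _ ys zs), aP _ (memM _ _ ys zs)).
  rewrite -vE -wE -tE -uE !c0E; split.
  + apply/eqP; rewrite -subr_eq0; apply/eqP.
    have := xP ('X_v - ('X_t + 'X_u)).
    rewrite !raddfB !raddfD /= !mmapX !mmap1U vE tE uE.
    by apply; rewrite -opprD subrr.
  + apply/eqP; rewrite -subr_eq0; apply/eqP.
    have := xP ('X_w - 'X_t * 'X_u).
    rewrite !raddfB /= !rmorphM /= !mmapX !mmap1U wE tE uE subrr.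
    by move=> /(_ erefl).
  + move=> xtu; apply/eqP; rewrite tE uE; apply: contrapT => /negP yz.
    have [v' v'E] := aP _ (memV _ _ ys zs).
    have := xP ('X_v' * ('X_t - 'X_u) - 1).
    rewrite !raddfB /= !rmorphM /= !raddfB /= !rmorph1 !mmapX !mmap1U v'E tE uE.
    rewrite mulVf ?subr_eq0 // subrr => /(_ erefl) /eqP.
    by rewrite xtu subrr mulr0 sub0r oppr_eq0 oner_eq0.
- move=> k /InP ks; have [t tE] := aP _ (mem1 _ ks); rewrite -tE c0E.
  apply/eqP; rewrite -subr_eq0; apply/eqP.
  have := xP ('X_t - k%:MP); rewrite !raddfB /= !mmapX !mmap1U !mmapC tE subrr.
  by move=> /(_ erefl).
Qed.

(** * From models of the companion to the geometric condition *)

Lemma retracts_on_sub (M N : dstruct) (h : M -> N) s s' c :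
  (forall x, List.In x s' -> List.In x s) -> retracts_on h s c -> retracts_on h s' c.
Proof.
move=> ss' [c01 cND cDM ck]; split=> //.
- by move=> x /ss'; apply: cND.
- by move=> x y /ss' xs /ss' ys; apply: cDM.
- by move=> k /ss'; apply: ck.
Qed.

Lemma locally_retractable_comp (M N P : dstruct) (h : M -> N) (g : N -> P) :
  embedding g -> locally_retractable (g \o h) -> locally_retractable h.
Proof.
move=> [g_inj [g0 g1] gDM gN gd] lr s; have [c [c01 cND cDM ck]] := lr (map g s).
have inS x : List.In x s -> List.In (g x) (map g s) by apply: List.in_map.
exists (c \o g); split=> /=.
- by rewrite g0 g1.
- by move=> x /inS /cND; rewrite gN gd.
- move=> x y xs ys; have [gD gM] := gDM x y; rewrite gD gM.
  by have [cD cM ci] := cDM _ _ (inS _ xs) (inS _ ys); split=> // /ci /g_inj.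
- by move=> k /inS; apply: ck.
Qed.

Section Polynomials.
Variables (K L : fieldType) (d : K -> K) (D : L -> L) (phi : {rmorphism K -> L}).
Local Notation KD := (dstruct_of d).
Local Notation LD := (dstruct_of D).

(** The finite set s contains the values of all subexpressions of f at w. *)
Lemma retract_mpoly m (w : 'I_m -> L) (f : {mpoly K[m]}) :
  exists s : seq L, forall c : L -> K, @retracts_on KD LD phi s c ->
    c (mmap phi w f) = mmap idfun (c \o w) f.
Proof.
pose P v (u : (L -> K) -> K) := exists s : seq L, forall c : L -> K,
  @retracts_on KD LD phi s c -> c v = u c.
have PD v u v' u' : P v u -> P v' u' -> P (v + v') (fun c => u c + u' c).
  move=> [s sP] [s' s'P]; exists ([:: v; v'] ++ s ++ s') => c cP.
  have [|cD _ _] := let: And4 _ _ H _ := cP in H v v' (or_introl erefl).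
    by right; left.
  rewrite [LHS]cD sP ?s'P //; apply: retracts_on_sub cP => x xs /=; right; right.
    by apply/InP; rewrite mem_cat; move/InP: xs => ->; rewrite orbT.
  by apply/InP; rewrite mem_cat; move/InP: xs => ->.
have PM v u v' u' : P v u -> P v' u' -> P (v * v') (fun c => u c * u' c).
  move=> [s sP] [s' s'P]; exists ([:: v; v'] ++ s ++ s') => c cP.
  have [|_ cD _] := let: And4 _ _ H _ := cP in H v v' (or_introl erefl).
    by right; left.
  rewrite [LHS]cD sP ?s'P //; apply: retracts_on_sub cP => x xs /=; right; right.
    by apply/InP; rewrite mem_cat; move/InP: xs => ->; rewrite orbT.
  by apply/InP; rewrite mem_cat; move/InP: xs => ->.
have P1 : P 1 (fun=> 1) by exists [::] => c [[]].
have PC k : P (phi k) (fun=> k).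
  by exists [:: phi k] => c [_ _ _]; apply; left.
have PW j : P (w j) (fun c => c (w j)) by exists [::].
pose Q g := P (mmap phi w g) (fun c => mmap idfun (c \o w) g).
have ext v u u' : (forall c, u c = u' c) -> P v u -> P v u'.
  by move=> uu' [s sP]; exists s => c /sP ->.
have QX a : Q 'X_[a].
  rewrite mpolyXE_id /Q.
  elim/big_ind: _ => [|f1 f2 Q1 Q2|j _].
  - by rewrite rmorph1; apply: ext P1 => c; rewrite rmorph1.
  - by rewrite rmorphM; apply: ext (PM _ _ _ _ Q1 Q2) => c; rewrite rmorphM.
  elim: (a j) => [|k IH].
    by rewrite expr0 rmorph1; apply: ext P1 => c; rewrite rmorph1.
  rewrite exprS rmorphM /= mmapX mmap1U.
  by apply: ext (PM _ _ _ _ (PW j) IH) => c; rewrite rmorphM /= mmapX mmap1U.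
suff : Q f by [].
elim/mpolyind: f => [|k a f _ _ IH].
  rewrite /Q mmap0; apply: ext (_ : P 0 (fun=> 0)) => [c|]; first by rewrite mmap0.
  by exists [::] => c [[]].
rewrite /Q mmapD mmapZ; apply: ext (PD _ _ _ _ (PM _ _ _ _ (PC k) (QX a)) IH) => c.
by rewrite mmapD mmapZ.
Qed.

End Polynomials.

(** On K(V), generated by the coordinates A = w (lshift m t), the derivation is
    induced by f |-> prolong f evaluated at the generic point (A, B) of W; it is
    well defined since prolong maps the ideal of V into that of W. *)
Lemma prolong_extension p n (K k L : fieldType) (d : K -> K) m
    (rV : {rmorphism {mpoly K[m]} -> k}) (rW : {rmorphism {mpoly K[m + m]} -> L})
    (phi : {rmorphism k -> L}) :
  p \in [pchar K] -> Fr_derivation p n d ->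
  (forall x, exists f g, rV g != 0 /\ x = rV f / rV g) ->
  (forall x, exists f g, rW g != 0 /\ x = rW f / rW g) ->
  (forall f, phi (rV f) = rW (in_X f)) -> separable_ext p phi ->
  (forall f, rV f = 0 -> rW (prolong p n d f) = 0) ->
  exists D : L -> L,
    [/\ Fr_derivation p n D, forall c, rW (d c)%:MP = D (rW c%:MP)
      & forall t, rW 'X_(rshift m t) = D (rW 'X_(lshift m t))].
Proof.
move=> charK d_der rVsurj rWsurj phiE sep delta0.
pose kappa : {rmorphism K -> L} := rW \o @mpolyC (m + m) K.
pose w j := rW 'X_j; pose A t := w (lshift m t); pose B t := w (rshift m t).
have rWmap f : rW f = mmap kappa w f by exact: rmorph_mpolyE.
have charL : p \in [pchar L] by rewrite (fmorph_pchar kappa).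
have phirV f : phi (rV f) = mmap kappa A f by rewrite phiE rWmap mmap_in_X.
pose delta f := rW (prolong p n d f).
have deltaE f : delta f = mprolong p n kappa (kappa \o d) A B f.
  by rewrite /delta rWmap (mmap_prolong _ _ _ d_der).
have kd_frob : frob_derivation (p ^ n) kappa (kappa \o d).
  by apply: frob_derivation_comp.
have delta_der : frob_derivation (p ^ n) (phi \o rV) delta.
  have [mD mM] := mprolong_frob_derivation charL kd_frob A B.
  by split=> f g; rewrite !deltaE ?mD ?mM //= !phirV.
have [Dk [Dk_der DkE]] := frac_derivation charL rVsurj delta_der delta0.
have phi_free := separable_pow_lin_free charL sep.
have gen x : exists f g, mmap phi B g != 0 /\ x = mmap phi B f / mmap phi B g.
  pose z j := match split j with inl t => (rV 'X_t)%:MP_[m] | inr t => 'X_t end.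
  pose up (f : {mpoly K[m + m]}) : {mpoly k[m]} := mmap (fun c => (rV c%:MP)%:MP) z f.
  have upE f : mmap phi B (up f) = rW f.
    rewrite rWmap (@rmorph_mmap _ _ _ _ _ _ (mmap phi B : {rmorphism {mpoly k[m]} -> L})).
    apply: eq_mmap => [c|j] /=; first by rewrite mmapC /= phirV mmapC.
    rewrite /z -{2}(splitK j); case: (split j) => t /=.
      by rewrite mmapC /= phirV mmapX mmap1U.
    by rewrite mmapX mmap1U.
  by have [f [g [g0 ->]]] := rWsurj x; exists (up f), (up g); rewrite !upE.
have [D [D_der DE]] := separable_derivation_extension charL phi_free Dk_der gen.
exists D; split=> //.
- move=> c; have -> : rW c%:MP = phi (rV c%:MP) by rewrite phirV mmapC.
  by rewrite DE DkE deltaE mprolongC.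
- move=> t; have -> : rW 'X_(lshift m t) = phi (rV 'X_t) by rewrite phirV mmapX mmap1U.
  by rewrite DE DkE deltaE mprolongX.
Qed.

(** The generic point of W is (a, D a) for a derivation D of the function field
    of W. *)
Lemma generic_point_extension p n (K : fieldType) (d : K -> K)
    (Omega : closedFieldType) (iota : {rmorphism K -> Omega}) m
    (V : irr_variety iota m) (W : irr_variety iota (m + m)) :
  p \in [pchar K] -> Fr_derivation p n d ->
  (forall w, W w -> twisted_bundle iota p n d V w) -> separable_proj p V W ->
  exists (L : fieldType) (D : L -> L) (kappa : {rmorphism K -> L})
      (w : 'I_(m + m) -> L),
    [/\ Fr_derivation p n D, forall k, kappa (d k) = D (kappa k),
        forall t, w (rshift m t) = D (w (lshift m t))
      & forall f, vanishing iota W f -> mmap kappa w f = 0].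
Proof.
move=> charK d_der WV [_ [phi [phiE sep]]].
have [rV [rVE rVker rVsurj]] := regular_fun_rmorphism V.
have [rW [rWE rWker rWsurj]] := regular_fun_rmorphism W.
have phiE' f : phi (rV f) = rW (in_X f) by rewrite rVE phiE rWE.
have delta0 f : rV f = 0 -> rW (prolong p n d f) = 0.
  move=> /rVker Vf; apply/rWker => z Wz; apply: (WV z Wz) => I _; apply.
  by exists f => //; right.
have [D [D_der Dd DX]] :=
  prolong_extension charK d_der rVsurj rWsurj phiE' sep delta0.
exists _, D, (rW \o @mpolyC (m + m) K), (fun j => rW 'X_j); split=> //.
by move=> f /rWker; rewrite rmorph_mpolyE.
Qed.

Lemma rmorphism_embedding (K L : fieldType) (d : K -> K) (D : L -> L)
    (phi : {rmorphism K -> L}) :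
  (forall k, phi (d k) = D (phi k)) -> @embedding (dstruct_of d) (dstruct_of D) phi.
Proof.
move=> phid; split=> //=; first exact: fmorph_inj.
- by rewrite rmorph0 rmorph1.
- by move=> x y; rewrite rmorphD rmorphM.
- exact: rmorphN.
Qed.

Lemma embedding_rmorphism (K L : fieldType) (d : K -> K) (D : L -> L) (g : K -> L) :
  @embedding (dstruct_of d) (dstruct_of D) g ->
  exists2 h : {rmorphism K -> L}, (h : K -> L) = g & forall k, h (d k) = D (h k).
Proof.
case=> /= _ [g0 g1] gDM gN gd.
have gB : zmod_morphism g by move=> x y; rewrite (gDM x _).1 gN.
have gM : monoid_morphism g by split=> // x y; case: (gDM x y).
pose gZ := GRing.isZmodMorphism.Build _ _ g gB.
pose gMM := GRing.isMonoidMorphism.Build _ _ g gM.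
by exists (HB.pack g gZ gMM : {rmorphism K -> L}).
Qed.

Lemma companion_geometric p n (K : fieldType) (d : K -> K)
    (Omega : closedFieldType) (iota : {rmorphism K -> Omega}) (T : theory) :
  p \in [pchar K] -> Fr_derivation p n d ->
  embeds_in_models (FrDF p n) T -> model_complete T ->
  models (dstruct_of d) T -> geometric_axiom p n d iota.
Proof.
move=> charK d_der Temb Tmc KT m V W WV sepVW.
have [[WV1 _] _] := sepVW.
have [L [D [kappa [w [D_der kd wD wW]]]]] := generic_point_extension charK d_der WV sepVW.
have kappa_emb := rmorphism_embedding kd.
have charL : p \in [pchar L] by rewrite (fmorph_pchar kappa).
have [N [g [NT g_emb]]] := Temb _ (models_FrDF charL D_der).
have lr : @locally_retractable (dstruct_of d) (dstruct_of D) kappa.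
  apply: (locally_retractable_comp g_emb); apply: elementary_locally_retractable.
  by apply: Tmc => //; apply: embedding_comp g_emb kappa_emb.
have [IW [IW_id WE]] := irr_is_variety W.
have [gs [gsI gsgen]] := hilbert_basis IW_id.
have IWv f : IW f -> mmap kappa w f = 0.
  by move=> If; apply: wW => z /WE/(_ _ If).
have /choice[S SP] := @retract_mpoly K L d D kappa _ w.
pose As := [seq w (lshift m t) | t <- enum 'I_m].
have [c cP] := lr (flatten (map S gs) ++ As).
have cS f : f \in gs -> mmap idfun (c \o w) f = 0.
  move=> fs; rewrite -(SP f).
    by rewrite (IWv f (gsI f fs)); case: cP => [[]].
  apply: retracts_on_sub cP => x /InP xS; apply/InP; rewrite mem_cat; apply/orP; left.
  by apply/flattenP; exists (S f) => //; apply: map_f.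
have cD t : c (w (rshift m t)) = d (c (w (lshift m t))).
  have [_ cND _ _] := cP; rewrite wD; apply: (cND _ _).2; apply/InP.
  by rewrite mem_cat; apply/orP; right; apply: map_f; rewrite mem_enum.
pose a : 'rV[K]_m := \row_t c (w (lshift m t)).
have Wa : W (row_mx (map_mx iota a) (map_mx (iota \o d) a)).
  apply/WE => f /gsgen Gf; apply: (Gf (fun f => peval iota f _ = 0)) => [|h hs].
    split; [exact: peval0|by move=> ? ? e1 e2; rewrite pevalD e1 e2 addr0|].
    by move=> ? ? e; rewrite pevalM e mulr0.
  rewrite -(rmorph0 iota) -(cS h hs) rmorph_mmap; apply: eq_mmap => // j.
  rewrite -(splitK j); case: (split j) => t /=.
    by rewrite row_mxEl !mxE.
  by rewrite row_mxEr !mxE cD.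
exists a; split=> //.
by have := WV1 _ Wa; rewrite row_mxKl.
Qed.

Theorem mainTheorem3 (p n : nat) (K : fieldType) (d : K -> K)
    (Omega : closedFieldType) (iota : {rmorphism K -> Omega})
    (FrDCF : theory)
    (p_prime : prime p) (n_ge1 : (1 <= n)%N) (charK : p \in [pchar K])
    (d_derivation : Fr_derivation p n d)
    (Omega_big : infinite_trdeg iota)
    (FrDCF_companion : model_companion (FrDF p n) FrDCF) :
  models (dstruct_of d) FrDCF <->
  forall (m : nat) (V : irr_variety iota m) (W : irr_variety iota (m + m)),
    (forall w, W w -> twisted_bundle iota p n d V w) ->
    separable_proj p V W ->
    exists a : 'rV[K]_m,
      V (map_mx iota a) /\ W (row_mx (map_mx iota a) (map_mx (iota \o d) a)).
Proof.
have [Tsent Temb Temb' Tmc] := FrDCF_companion.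
split; first exact: companion_geometric.
move=> geom.
have [N [g [NT g_emb]]] := Temb _ (models_FrDF charK d_derivation).
(* The axioms of FrDF say that M is a field, which is how field theory reaches
   the extension N of K. *)
have [M [g' [MT g'_emb]]] := Temb' N NT.
have [F [D [charF D_der ME]]] := FrDF_model p_prime MT.
have lr : locally_retractable g.
  apply: (locally_retractable_comp g'_emb).
  move: g' g'_emb; rewrite -ME => g' g'_emb.
  have [h hE hd] := embedding_rmorphism (embedding_comp g'_emb g_emb).
  by have := geometric_locally_retractable d_derivation geom charF D_der hd; rewrite hE.
have g_el := locally_retractable_elementary Tmc NT g_emb lr.
by move=> f Tf e; apply/g_el; apply: NT.
Qed.
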